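(* Let $E=w(L^* )\cap[0,1)$, and for each $\delta\in E$ put $$I_\delta=\{1\le i\le t\mid \delta\in e_i^{-1}\mathbb{Z}\},\qquad f_\delta=\sum_{i\in I_\delta}f_i .$$ Then, for any reduced integral basis $\mathcal{B}$ of $L/K$ and every $\delta\in E$, one has $\#\{\alpha\in\mathcal{B}\mid w(\alpha)=\delta\}=f_\delta$. In other words, the multiset $w(\mathcal{B})$ is equal to the multiset $W_{L/K}:=\{\delta^{f_\delta}\mid\delta\in E\}$, in which each $\delta\in E$ occurs with multiplicity $f_\delta$.
   Context: $v\colon K\to\mathbb{Z}\cup\{\infty\}$ is a (normalized) discrete valuation on a field $K$, with valuation ring $A$, uniformizer $\pi\in A$, maximal ideal $\mathfrak{m}=\pi A$ and residue field $k=A/\mathfrak{m}$. $L=K(\theta)$ is a finite extension of $K$ of degree $n>1$, where $\theta$ is a root of a monic irreducible polynomial $f\in A[x]$ of degree $n$. $B\subset L$ is the integral closure of $A$ in $L$, assumed to be finitely generated as an $A$-module (hence free of rank $n$). An integral basis of $L/K$ is an $A$-basis of $B$ (sometimes regarded just as a subset of $B$). $w_1,\dots,w_t$ are the valuations on $L$ extending $v$; for each $i$, $k_i$ is the residue field of $w_i$, $f_i=[k_i\colon k]$, and $e_i=e(w_i/v)$ is the ramification index, so that $w_i(L^* )=e_i^{-1}\mathbb{Z}$. The function $w\colon L\to\mathbb{Q}\cup\{\infty\}$ is defined by $w(\alpha)=\min\{w_i(\alpha)\mid 1\le i\le t\}$. A subset $\{\alpha_1,\dots,\alpha_d\}\subset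 L^*$ is called reduced if $w\left(\sum_{j=1}^d a_j\alpha_j\right)=\min\{w(a_j\alpha_j)\mid 1\le j\le d\}$ for all $a_1,\dots,a_d\in K$. A reduced integral basis is an integral basis that is a reduced set. For an integral basis $\mathcal{B}$ one has $w(\mathcal{B})\subset[0,1)$. *)

(* Defs.v *)
From HB Require Import structures.
From mathcomp Require Import all_boot all_order all_algebra all_field.
From mathcomp Require Import finmap.
From mathcomp Require Import boolp classical_sets functions cardinality.
From mathcomp Require Import constructive_ereal.

Set Implicit Arguments.
Unset Strict Implicit.
Unset Printing Implicit Defensive.

Import Order.TTheory GRing.Theory Num.Theory.
Local Open Scope quotient_scope.
Local Open Scope ring_scope.

(* [\bar G] also contains [-oo], which is excluded explicitly. *)
Record valuation (F : fieldType) (G : realDomainType) := Valuation {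
  val_fun :> F -> \bar G;
  valNy : forall x, val_fun x != -oo%E;
  valy : forall x, (val_fun x == +oo%E) = (x == 0);
  valM : forall x y, val_fun (x * y) = (val_fun x + val_fun y)%E;
  val_min : forall x y,
    (Order.min (val_fun x) (val_fun y) <= val_fun (x + y))%E
}.

Section ResidueField.
Variables (F : fieldType) (G : realDomainType) (v : valuation F G).

Lemma val0 : v 0 = +oo%E.
Proof. by apply/eqP; rewrite valy. Qed.

Lemma val_fin x : x != 0 -> exists g : G, v x = g%:E.
Proof.
rewrite -(valy v) => vx; have := valNy v x.
by case: (v x) vx => [g||] // _ _; exists g.
Qed.

Lemma val1 : v 1 = 0%E.
Proof.
have [g vg] := val_fin (oner_neq0 F).
move: (valM v 1 1); rewrite mulr1 vg -EFinD => -[] gE; congr (_%:E).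
by apply: (addrI g); rewrite addr0 -gE.
Qed.

Lemma valN1 : v (-1) = 0%E.
Proof.
have N1 : (-1 : F) != 0 by rewrite oppr_eq0 oner_neq0.
have [g vg] := val_fin N1; rewrite vg.
move: (valM v (-1) (-1)); rewrite mulrNN mulr1 val1 vg -EFinD => -[] /esym/eqP.
by rewrite -mulr2n mulrn_eq0 /= => /eqP ->.
Qed.

Lemma valN x : v (- x) = v x.
Proof. by rewrite -mulN1r valM valN1 add0e. Qed.

Definition vring : {pred F} := fun x => (0 <= v x)%E.

Lemma vring_subring : subring_closed vring.
Proof.
split=> [|x y|x y]; rewrite ?inE /in_mem /= /vring.
- by rewrite val1.
- move=> vx vy; apply: le_trans (val_min v _ _).
  by rewrite le_min valN vx vy.
- by move=> vx vy; rewrite valM adde_ge0.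
Qed.
HB.instance Definition _ := GRing.isSubringClosed.Build F vring vring_subring.

Definition valuation_ring := {x : F | x \in vring}.
HB.instance Definition _ := SubChoice.on valuation_ring.
HB.instance Definition _ := [SubChoice_isSubComNzRing of valuation_ring by <:].

Definition max_ideal : {pred valuation_ring} := fun a => (0 < v (val a))%E.

Lemma max_ideal_closed : idealr_closed max_ideal.
Proof.
split; rewrite ?inE /in_mem /= /max_ideal.
- by rewrite rmorph0 val0 lt0y.
- by rewrite rmorph1 val1 ltxx.
- move=> a x y vx vy; rewrite rmorphD rmorphM.
  apply: lt_le_trans (val_min v _ _).
  rewrite lt_min; apply/andP; split; last exact: vy.
  by rewrite valM; apply: (lt_le_trans vx); rewrite leeDr //; apply: (valP a).
Qed.
HB.instance Definition _ := isIdealr.Build valuation_ring max_ideal max_ideal_closed.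

Definition residue_field := {ideal_quot max_ideal}.
HB.instance Definition _ := GRing.ComNzRing.on residue_field.

Local Notation pi := (\pi_residue_field).

Lemma pi_eq (a b : valuation_ring) : (pi a == pi b) = (a - b \in max_ideal).
Proof. by rewrite -Quotient.idealrBE. Qed.

Lemma pi0 : pi 0 = 0. Proof. by rewrite !piE. Qed.

Lemma pi1 : pi 1 = 1. Proof. by rewrite !piE. Qed.

Lemma piD a b : pi (a + b) = pi a + pi b. Proof. by rewrite !piE. Qed.

Lemma piM a b : pi (a * b) = pi a * pi b. Proof. by rewrite !piE. Qed.

Lemma vring_inv (a : valuation_ring) :
  a \notin max_ideal -> (val a)^-1 \in vring.
Proof.
rewrite unfold_in /max_ideal -leNgt => va.
suff : (0 <= v (val a)^-1%R)%E by [].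
have [->|a0] := eqVneq (val a) 0; first by rewrite invr0 val0 leey.
have a0' : (val a)^-1 != 0 by rewrite invr_eq0.
have := valM v (val a) (val a)^-1; rewrite divff // val1.
have [g vg] := val_fin a0; have [h vh] := val_fin a0'.
move: va; rewrite vg vh !lee_fin -EFinD => g0 [] /esym/eqP.
by rewrite addrC addr_eq0 => /eqP ->; rewrite oppr_ge0.
Qed.

Definition residue_inv (x : residue_field) : residue_field :=
  if boolP (repr x \in max_ideal) is AltFalse xm
  then pi (exist _ (val (repr x))^-1 (vring_inv xm)) else 0.

Lemma residue_mulVf x : x != 0 -> residue_inv x * x = 1.
Proof.
move=> x0; rewrite /residue_inv; case: {-}_ / boolP => xm.
  by move: x0; rewrite -[x]reprK -pi0 pi_eq subr0 xm.
set y := exist _ _ _; rewrite -[X in _ * X]reprK.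
rewrite -piM -pi1; congr (pi _); apply: val_inj; rewrite rmorphM rmorph1 /=.
apply: mulVf; apply/eqP => rx0; case/negP: (xm).
by rewrite unfold_in /max_ideal /= [X in v X]rx0 val0 lt0y.
Qed.

Lemma residue_inv0 : residue_inv 0 = 0.
Proof.
rewrite /residue_inv; case: {-}_ / boolP => // xm; case/negP: (xm).
by rewrite -[repr _]subr0 -pi_eq reprK pi0.
Qed.

HB.instance Definition _ :=
  GRing.ComNzRing_isField.Build residue_field residue_mulVf residue_inv0.

End ResidueField.
Arguments vring {F G} v.
Arguments valuation_ring {F G} v.
Arguments max_ideal {F G} v.
Arguments residue_field {F G} v.

Definition normalized (K : fieldType) (v : valuation K int) :=
  forall z : int, exists x, v x = z%:E.

Definition extends (K : fieldType) (L : fieldExtType K)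
    (v : valuation K int) (w : valuation L rat) :=
  forall x : K, w x%:A = er_map intr (v x).

Section Extension.
Variables (K : fieldType) (L : fieldExtType K).
Variables (v : valuation K int) (w : valuation L rat).

Section ResidueExtension.
Hypothesis vw : extends v w.

Lemma vring_ext (a : valuation_ring v) : (val a)%:A \in vring w.
Proof.
rewrite unfold_in /vring vw.
have := valP a; rewrite unfold_in /vring.
by case: (v _) => [z||] //=; rewrite !lee_fin ler0z.
Qed.

Definition vring_map (a : valuation_ring v) : valuation_ring w :=
  exist _ (val a)%:A (vring_ext a).

Definition residue_map (x : residue_field v) : residue_field w :=
  \pi_(residue_field w) (vring_map (repr x)).

Lemma residue_mapE a :
  residue_map (\pi_(residue_field v) a) = \pi_(residue_field w) (vring_map a).
Proof.
apply/eqP; rewrite pi_eq; set b := repr _.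
have : b - a \in max_ideal v by rewrite -pi_eq reprK.
rewrite !unfold_in /max_ideal !rmorphB /= -scalerBl vw.
by case: (v _) => [z||] //=; rewrite !lte_fin ltr0z.
Qed.

Definition residue_ext of extends v w := residue_field w.

Local Notation k_w := (residue_ext vw).

HB.instance Definition _ := GRing.Field.on k_w.

Definition residue_scale (c : residue_field v) (x : k_w) : k_w :=
  residue_map c * x.

Lemma residue_map1 : residue_map 1 = 1.
Proof.
rewrite -!pi1 residue_mapE; congr (\pi_(residue_field w) _).
by apply: val_inj; rewrite /= scale1r.
Qed.

Lemma residue_mapD x y : residue_map (x + y) = residue_map x + residue_map y.
Proof.
rewrite -[x]reprK -[y]reprK.
rewrite -piD !residue_mapE -piD.
congr (\pi_(residue_field w) _).
by apply: val_inj; rewrite rmorphD /= scalerDl.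
Qed.

Lemma residue_mapM x y : residue_map (x * y) = residue_map x * residue_map y.
Proof.
rewrite -[x]reprK -[y]reprK.
rewrite -piM !residue_mapE -piM.
congr (\pi_(residue_field w) _).
by apply: val_inj; rewrite rmorphM /= -scalerAl mul1r scalerA.
Qed.

Lemma residue_scaleA a b x :
  residue_scale a (residue_scale b x) = residue_scale (a * b) x.
Proof. by rewrite /residue_scale residue_mapM mulrA. Qed.

Lemma residue_scale1 : left_id 1 residue_scale.
Proof. by move=> x; rewrite /residue_scale residue_map1 mul1r. Qed.

Lemma residue_scaleDr : right_distributive residue_scale +%R.
Proof. by move=> a x y; rewrite /residue_scale mulrDr. Qed.

Lemma residue_scaleDl x : {morph residue_scale^~ x : a b / a + b}.
Proof. by move=> a b; rewrite /residue_scale residue_mapD mulrDl. Qed.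

HB.instance Definition _ := GRing.Zmodule_isLmodule.Build (residue_field v) k_w
  residue_scaleA residue_scale1 residue_scaleDr residue_scaleDl.

(* The value is 0 when k_w has infinite dimension over the residue field of v. *)
Definition residue_degree : nat :=
  xget 0%N [set d | inhabited (Vector.axiom d k_w)].

End ResidueExtension.

Local Open Scope classical_set_scope.

Definition base_value_group : set rat :=
  [set q | exists2 x : K, x != 0 & er_map intr (v x) = q%:E].

Definition value_group : set rat :=
  [set q | exists2 x : L, x != 0 & w x = q%:E].

(* The number of cosets of v(K^* ) in w(L^* ); the value is 0 if the index is
   infinite. *)
Definition ramification_index : nat :=
  #|` fset_set [set [set q + h | h in base_value_group] | q in value_group]|.

End Extension.

Section IntegralBasis.
Variables (K : fieldType) (L : fieldExtType K) (v : valuation K int).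

Definition integral (x : L) :=
  integralOver (fun a : valuation_ring v => (val a)%:A) x.

Definition vring_span (S : {fset L}) (x : L) :=
  exists a : L -> valuation_ring v, x = \sum_(s <- S) val (a s) *: s.

Definition vring_free (S : {fset L}) :=
  forall a : L -> valuation_ring v,
    \sum_(s <- S) val (a s) *: s = 0 -> {in S, forall s, a s = 0}.

Definition integral_closure_fg :=
  exists S : {fset L}, forall x, integral x <-> vring_span S x.

Definition integral_basis (S : {fset L}) :=
  (forall x, integral x <-> vring_span S x) /\ vring_free S.

End IntegralBasis.

Section MinValuation.
Variables (K : fieldType) (L : fieldExtType K) (v : valuation K int).
Variables (t : nat) (w : 'I_t -> valuation L rat).

Definition wmin (x : L) : \bar rat :=
  \big[Order.min/+oo%E]_(i < t) w i x.

Definition reduced (S : {fset L}) :=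
  0 \notin S /\
  forall a : L -> K,
    wmin (\sum_(s <- S) a s *: s) =
    \big[Order.min/+oo%E]_(s <- S) wmin (a s *: s).

Definition reduced_integral_basis (S : {fset L}) :=
  integral_basis v S /\ reduced S.

Definition unit_interval_values : set rat :=
  [set d | (exists2 x : L, x != 0 & wmin x = d%:E) /\ 0 <= d < 1]%classic.

Definition index_set (d : rat) : {set 'I_t} :=
  [set i | `[< exists m : int,
                 d = (ramification_index v (w i))%:R^-1 * m%:~R >]].

Hypothesis vw : forall i, extends v (w i).

Definition f_delta (d : rat) : nat :=
  (\sum_(i in index_set d) residue_degree (vw i))%N.

(* A multiset is given by its multiplicity function. *)
Definition multiset_W (q : \bar rat) : nat :=
  if q is d%:E then
    if `[< unit_interval_values d >] then f_delta d else 0%N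
  else 0%N.

End MinValuation.

(* Main.v *)
Require Import Defs.
From HB Require Import structures.
From mathcomp Require Import all_boot all_order all_algebra all_field.
From mathcomp Require Import finmap.
From mathcomp Require Import boolp classical_sets functions cardinality.
From mathcomp Require Import constructive_ereal.
From mathcomp Require Import ring lra zify.

Set Implicit Arguments.
Unset Strict Implicit.
Unset Printing Implicit Defensive.

Import Order.TTheory GRing.Theory Num.Theory.
Local Open Scope ring_scope.

(** The multiplicity of a value [delta] in [0, 1) is the dimension over the
    residue field k of the graded piece V = {w >= delta} / {w > delta} of the
    filtration of L by w, and V can be computed in two ways.

    From the side of the valuations: if delta is not a value of w_i, then
    w_i >= delta already forces w_i > delta, so w_i does not contribute to V.
    For the other i, those of [index_set] (by [value_groupE], which identifies
    w_i(L^* ) with e_i^-1 Z), choose c_i of value delta; then x |-> x / c_i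
    modulo the maximal ideal embeds V into the product of the residue fields
    k_i, and [weak_approximation] shows that the image is everything. Hence
    dim V is the sum of the f_i, which is [f_delta].

    From the side of the basis: the elements of a reduced integral basis have
    values in [0, 1) ([basis_wmin]). In a combination x of basis elements s with
    coefficients a_s, reducedness makes w(x) the least of the v(a_s) + w(s);
    since v(a_s) is an integer and both w(s) and delta lie in [0, 1), such a sum
    equals delta only if v(a_s) = 0 and w(s) = delta. So the basis elements of
    value delta form a k-basis of V. The proof compares the two descriptions
    directly: the classes of the s / c_i are shown to span ([level_span]) and to
    be free ([level_free]) in the product of the k_i, and
    [card_product_basis] counts. That each k_i is finite-dimensional over k
    comes out of the same argument, because k_i is a quotient of the product.

    The bound w(s) < 1 rests on the equality of B with {w >= 0} ([integralP]),
    that is, on the existence of a valuation extending v that is negative at a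
    given non-integral x ([not_integral_ext]). It is obtained from a maximal
    subring of L containing A[1/x] but not x: such a ring is a valuation ring
    ([max_subring_valuation]), and as L is finite over K some power z^m with
    m > 0 of every nonzero z differs from a power of the uniformizer by a unit
    ([pow_unit]), so that the valuation ring carries a valuation with values in
    the rationals ([valuation_of_subring]). *)

(** * Valuations *)

Section Valuations.
Variables (F : fieldType) (G : realDomainType) (w : valuation F G).

Lemma val_sum_ge (I : Type) (r : seq I) (P : pred I) (f : I -> F) (m : \bar G) :
  (forall i, P i -> (m <= w (f i))%E) -> (m <= w (\sum_(i <- r | P i) f i)%R)%E.
Proof.
move=> mf; elim/big_ind: _ => // [|x y mx my]; first by rewrite val0 leey.
by apply: le_trans (val_min w x y); rewrite le_min mx my.
Qed.

Lemma val_sum_gt (I : Type) (r : seq I) (P : pred I) (f : I -> F) (m : G) :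
  (forall i, P i -> (m%:E < w (f i))%E) -> (m%:E < w (\sum_(i <- r | P i) f i)%R)%E.
Proof.
move=> mf; elim/big_ind: _ => // [|x y mx my]; first by rewrite val0 ltry.
by apply: lt_le_trans (val_min w x y); rewrite lt_min mx my.
Qed.

Lemma valD_lt x y : (w x < w y)%E -> w (x + y) = w x.
Proof.
move=> xy; apply/le_anti/andP; split; last first.
  by apply: le_trans (val_min w x y); rewrite le_min lexx ltW.
rewrite leNgt; apply/negP => h.
have := val_min w (x + y) (- y); rewrite addrK valN.
by rewrite leNgt lt_min h xy.
Qed.

(** On nonzero elements the valuation is finite, and [fine (w x)] turns its
    rules of calculation into identities of the ordered ring G. *)
Lemma valM0 x y : x != 0 -> y != 0 ->
  fine (w (x * y)) = fine (w x) + fine (w y).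
Proof.
move=> /val_fin-/(_ _ w)[a xa] /val_fin-/(_ _ w)[b yb].
by rewrite Defs.valM xa yb.
Qed.

Lemma valE x : x != 0 -> w x = (fine (w x))%:E.
Proof. by move=> /val_fin-/(_ _ w)[a ->]. Qed.

Lemma valV0 x : x != 0 -> fine (w x^-1) = - fine (w x).
Proof.
move=> x0; apply/eqP; rewrite -addr_eq0 -valM0 ?invr_eq0 //.
by rewrite mulVf // Defs.val1.
Qed.

Lemma valX0 x m : x != 0 -> fine (w (x ^+ m)) = fine (w x) *+ m.
Proof.
move=> x0; elim: m => [|m IH]; first by rewrite expr0 Defs.val1.
by rewrite exprS mulrS valM0 ?expf_neq0 // IH.
Qed.

Lemma valXz0 x (m : int) : x != 0 -> fine (w (x ^ m)) = fine (w x) *~ m.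
Proof.
move=> x0; case: m => m; first by rewrite -exprnP valX0 // -pmulrn.
by rewrite NegzE -exprnN valV0 ?expf_neq0 // valX0 // mulrNz.
Qed.

Lemma val_lt0_neq0 x : (w x < 0)%E -> x != 0.
Proof. by apply: contraTneq => ->; rewrite val0 -leNgt leey. Qed.

(** In x^n = - \sum_(i < n) p_i x^i, a value w x < 0 would make every term on the
    right strictly larger than w (x^n). *)
Lemma val_root_monic (p : {poly F}) x :
  p \is monic -> (forall i, (0 <= w p`_i)%E) -> root p x -> (0 <= w x)%E.
Proof.
move=> pm p0 /rootP; rewrite horner_coef => e.
rewrite leNgt; apply/negP => x0.
have xn0 := val_lt0_neq0 x0.
case sp : (size p) => [|m].
  by move: (monic_neq0 pm); rewrite -size_poly_eq0 sp.
move: e; rewrite sp big_ord_recr /=.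
have -> : p`_m = 1 by move/monicP: pm; rewrite lead_coefE sp.
rewrite mul1r => /eqP; rewrite addr_eq0 => /eqP e.
have : (w (x ^+ m)%R < w (- x ^+ m)%R)%E.
  rewrite -e valE ?expf_neq0 //; apply: val_sum_gt => i _.
  rewrite Defs.valM; apply: (@lt_le_trans _ _ (w (x ^+ i)%R)); last first.
    by rewrite leeDr.
  rewrite (valE (x := x ^+ i)) ?expf_neq0 // lte_fin !valX0 //.
  by rewrite ltr_nMn2l // -lte_fin -valE.
by rewrite valN ltxx.
Qed.

End Valuations.

(** * Maximal subrings avoiding an element *)

Section MaximalSubrings.
Variable F : fieldType.
Implicit Types (R : set F) (x y z : F).

Definition subring_set R :=
  [/\ R 1, forall x y, R x -> R y -> R (x - y)
    & forall x y, R x -> R y -> R (x * y)].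

Definition adjoin_set R z : set F :=
  [set q | exists2 p : {poly F}, forall i, R p`_i & q = p.[z]]%classic.

Section Subring.
Variable R : set F.
Hypothesis Rring : subring_set R.

Lemma subring_set1 : R 1. Proof. by case: Rring. Qed.
Lemma subring_setB x y : R x -> R y -> R (x - y).
Proof. by case: Rring => _ + _; apply. Qed.
Lemma subring_setM x y : R x -> R y -> R (x * y).
Proof. by case: Rring => _ _; apply. Qed.
Lemma subring_set0 : R 0.
Proof. by rewrite -(subrr 1); apply: subring_setB subring_set1 subring_set1. Qed.
Lemma subring_setN x : R x -> R (- x).
Proof. by move=> Rx; rewrite -sub0r; apply: subring_setB subring_set0 Rx. Qed.
Lemma subring_setD x y : R x -> R y -> R (x + y).
Proof. by move=> Rx Ry; rewrite -[y]opprK; apply/subring_setB/subring_setN. Qed.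
Lemma subring_setX x m : R x -> R (x ^+ m).
Proof.
move=> Rx; elim: m => [|m IH]; first by rewrite expr0; apply: subring_set1.
by rewrite exprS; apply: subring_setM.
Qed.
Lemma subring_set_sum (I : Type) (r : seq I) (P : pred I) (f : I -> F) :
  (forall i, P i -> R (f i)) -> R (\sum_(i <- r | P i) f i).
Proof. by move=> Rf; elim/big_ind: _ => //; [apply: subring_set0 | apply: subring_setD]. Qed.

Lemma subring_adjoin z : subring_set (adjoin_set R z).
Proof.
split=> [|_ _ [p Rp ->] [q Rq ->]|_ _ [p Rp ->] [q Rq ->]].
- exists 1 => [i|]; last by rewrite hornerC.
  by rewrite coef1; case: (i == 0)%N; [apply: subring_set1 | apply: subring_set0].
- by exists (p - q) => [i|]; rewrite ?hornerE // coefB; apply: subring_setB.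
- exists (p * q) => [i|]; rewrite ?hornerM // coefM.
  by apply: subring_set_sum => j _; apply: subring_setM.
Qed.

Lemma adjoin_sub z x : R x -> adjoin_set R z x.
Proof.
move=> Rx; exists x%:P => [i|]; last by rewrite hornerC.
by rewrite coefC; case: (i == 0)%N => //; apply: subring_set0.
Qed.

Lemma adjoin_gen z : adjoin_set R z z.
Proof.
exists 'X => [i|]; last by rewrite hornerX.
by rewrite coefX; case: (i == 1)%N; [apply: subring_set1 | apply: subring_set0].
Qed.

End Subring.

(** Maximality among the subrings that contain R0 and avoid x, by Zorn: adjoining
    any further z to R brings x in. *)
Lemma max_subring_avoiding R0 x : subring_set R0 -> ~ R0 x ->
  exists R, [/\ subring_set R, (R0 `<=` R)%classic, ~ R x
    & forall z, ~ R z -> adjoin_set R z x].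
Proof.
move=> R0ring R0x.
pose good R := [/\ subring_set R, (R0 `<=` R)%classic & ~ R x].
(* The empty set is admitted so that the empty chain has an upper bound. *)
pose P : set (set F) := [set R | (R = set0 \/ good R)]%classic.
have [|R [[R_0|[Rring R0R Rx]] Rmax]] := @Zorn_bigcup F P.
- move=> C CP Ctot.
  have Cgood X z : C X -> X z -> good X.
    by move=> /CP[-> //|].
  have [[X CX Xn0]|noX] := pselect (exists2 X, C X & (X !=set0)%classic); last first.
    left; rewrite -subset0 => z [X CX Xz]; apply: noX.
    by exists X => //; exists z.
  right; have [z Xz] := Xn0; have [Xring R0X Xx] := Cgood _ _ CX Xz.
  split=> [|y R0y|[Y CY Yx]]; last 2 first.
  + by exists X => //; apply: R0X.
  + by have [_ _] := Cgood _ _ CY Yx; apply.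
  split; first by exists X => //; apply: subring_set1.
    move=> a b [Y CY Ya] [Z CZ Zb].
    have [[Yring _ _] [Zring _ _]] := (Cgood _ _ CY Ya, Cgood _ _ CZ Zb).
    case: (Ctot _ _ CY CZ) => YZ.
    + by exists Z => //; apply: subring_setB => //; apply: YZ.
    + by exists Y => //; apply: subring_setB => //; apply: YZ.
  move=> a b [Y CY Ya] [Z CZ Zb].
  have [[Yring _ _] [Zring _ _]] := (Cgood _ _ CY Ya, Cgood _ _ CZ Zb).
  case: (Ctot _ _ CY CZ) => YZ.
  + by exists Z => //; apply: subring_setM => //; apply: YZ.
  + by exists Y => //; apply: subring_setM => //; apply: YZ.
- exfalso; apply: (Rmax R0); last by right; split.
  rewrite R_0; split; first exact: sub0set.
  by move=> /(_ 1 (subring_set1 R0ring)).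
exists R; split=> // z Rz; apply: contrapT => nx.
apply: (Rmax (adjoin_set R z)).
  split=> [y Ry|]; first exact: adjoin_sub.
  by move=> /(_ z (adjoin_gen Rring z)).
right; split=> //; first exact: subring_adjoin.
by move=> y /R0R Ry; apply: adjoin_sub.
Qed.

Section ValuationSubring.
Variables (R : set F) (x : F).
Hypotheses (Rring : subring_set R) (Rx' : R x^-1) (Rx : ~ R x).
Hypothesis Rmax : forall z, ~ R z -> adjoin_set R z x.

Let x0 : x != 0.
Proof. by apply/eqP => xe; apply: Rx; rewrite xe; apply: subring_set0. Qed.

(** This makes R behave like a local ring with 1/x in its maximal ideal. If r is
    1 - b/x and 1/r is not in R, then x is a polynomial in 1/r, so x r^m is in R
    for some m; but x r is x up to an element of R, and x would be in R. *)
Lemma max_subring_unit b : R b -> R (1 - b * x^-1)^-1.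
Proof.
move=> Rb; set r := 1 - _; apply: contrapT => Rr'.
have Rr : R r by apply: subring_setB => //; [apply: subring_set1 | apply: subring_setM].
have r0 : r != 0.
  by apply/eqP => re; apply: Rr'; rewrite re invr0; apply: subring_set0.
have cancel m : R (x * r ^+ m) -> R x.
  elim: m => [|m IH]; first by rewrite mulr1.
  move=> h; apply: IH.
  have -> : x * r ^+ m = x * r ^+ m.+1 + b * r ^+ m.
    by rewrite exprS /r; field.
  by apply: subring_setD => //; apply: subring_setM => //; apply: subring_setX.
have [p Rp xE] := Rmax Rr'.
apply: Rx; apply: (cancel (size p)).
rewrite xE horner_coef mulr_suml; apply: subring_set_sum => // i _.
rewrite exprVn -mulrA; apply: subring_setM => //.
have -> : r ^+ size p = r ^+ i * r ^+ (size p - i).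
  by rewrite -exprD subnKC // ltnW.
by rewrite mulKf ?expf_neq0 //; apply: subring_setX.
Qed.

Let deg_le z m :=
  exists2 a : nat -> F, forall i, R (a i) & \sum_(i < m.+1) a i * z ^+ i = x.

(** The unit 1 - b_0/x allows the relation in 1/z to be solved for z^(m+1) in
    terms of lower powers of z. *)
Let deg_le_step z m : z != 0 -> deg_le z m.+1 -> deg_le z^-1 m.+1 -> deg_le z m.
Proof.
move=> z0 [a Ra ae] [b Rb be].
have Rc := max_subring_unit (Rb 0); set c := (_ - _)^-1 in Rc.
have c0 : 1 - b 0 * x^-1 != 0.
  apply/eqP => e; apply: Rx.
  have -> : x = b 0 * x^-1 * x + (1 - b 0 * x^-1) * x by ring.
  by rewrite e mul0r addr0 divfK.
have zE : z ^+ m.+1 = c * x^-1 * \sum_(i < m.+1) b (m - i).+1 * z ^+ i.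
  have -> : \sum_(i < m.+1) b (m - i).+1 * z ^+ i = (x - b 0) * z ^+ m.+1.
    have -> : x - b 0 = \sum_(i < m.+1) b (bump 0 i) * z^-1 ^+ bump 0 i.
      by rewrite -be big_ord_recl expr0 mulr1 addrC addKr.
    rewrite mulr_suml.
    rewrite (reindex_inj rev_ord_inj); apply: eq_bigr => i _ /=.
    rewrite subSS subKn -1?ltnS // -mulrA; congr (_ * _).
    have -> : z ^+ m.+1 = z ^+ bump 0 i * z ^+ (m - i).
      by rewrite -exprD; congr (_ ^+ _); rewrite /bump /=; have := ltn_ord i; lia.
    by rewrite exprVn mulKf ?expf_neq0.
  have -> : x - b 0 = (1 - b 0 * x^-1) * x by rewrite mulrBl mul1r divfK.
  by rewrite /c; move: c0; set r := 1 - _ => c0; field; rewrite x0.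
exists (fun i => a i + a m.+1 * (c * x^-1 * b (m - i).+1)) => [i|].
  by apply: subring_setD => //; do ! apply: subring_setM => //.
rewrite -[RHS]ae [RHS]big_ord_recr /= zE mulr_sumr mulr_sumr -big_split /=.
by apply: eq_bigr => i _; ring.
Qed.

(** If neither z nor 1/z were in R, then x would be a polynomial in z and also one
    in 1/z. The two relations lower the degree of each other until x is a
    constant, that is, an element of R. *)
Lemma max_subring_valuation z : R z \/ R z^-1.
Proof.
apply: contrapT => /not_orP[Rz Rz'].
have z0 : z != 0 by apply/eqP => ze; apply: Rz; rewrite ze; apply: subring_set0.
have deg y : ~ R y -> exists m, forall k, (m <= k)%N -> deg_le y k.
  move=> Ry; have [p Rp pE] := Rmax Ry.
  exists (size p) => k pk; exists (fun i => p`_i) => //.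
  rewrite pE (horner_coef_wide (n := k.+1)) //; exact: leqW.
have [[m zm] [m' zm']] := (deg _ Rz, deg _ Rz').
have := zm _ (leq_maxl m m'); have := zm' _ (leq_maxr m m').
elim: (maxn m m') => [|k IH]; last first.
  move=> dz' dz; apply: IH; last exact: deg_le_step.
  by apply: deg_le_step; rewrite ?invr_eq0 ?invrK.
by move=> _ [a Ra]; rewrite big_ord1 expr0 mulr1 => ax; apply: Rx; rewrite -ax.
Qed.

End ValuationSubring.

End MaximalSubrings.

(** * Valuation subrings of a finite extension *)

Section ValuationSubringsOfExtensions.
Variables (K : fieldType) (L : fieldExtType K) (v : valuation K int).
Variables (pi : K) (v_pi : v pi = 1%:E).

(** The minimal polynomial of z, with the bound on its degree that makes the
    denominators of the values uniformly bounded. *)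
Lemma root_monic_dim (z : L) : exists p : {poly K},
  [/\ p \is monic, (size p <= (\dim {:L}%VS).+1)%N & root (map_poly (in_alg L) p) z].
Proof.
have /polyOver1P[p pE] := minPolyOver 1 z.
exists p; split; last by rewrite -pE root_minPoly.
  by rewrite -(map_monic (in_alg L)) -pE monic_minPoly.
rewrite -(size_map_poly (in_alg L)) -pE size_minPoly ltnS adjoin_degreeE.
by rewrite dimv1 divn1 dimvS ?subvf.
Qed.

Section ValuationSubring.
Variable O : set L.
Hypotheses (Oring : subring_set O) (Oval : forall z, O z \/ O z^-1).
Hypothesis OK : forall c : K, O c%:A <-> (0 <= v c)%E.

Let O_unit (z : L) := O z /\ O z^-1.

Let O_unitM x y : O_unit x -> O_unit y -> O_unit (x * y).
Proof. by move=> [Ox Ox'] [Oy Oy']; split; rewrite ?invfM; apply: subring_setM. Qed.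

Let O_unitV x : O_unit x -> O_unit x^-1.
Proof. by move=> [Ox Ox']; split; rewrite ?invrK. Qed.

Let O_unitX x m : O_unit x -> O_unit (x ^+ m).
Proof. by move=> [Ox Ox']; split; rewrite -?exprVn; apply: subring_setX. Qed.

Let O_nonunit (z : L) := O z /\ (z <> 0 -> ~ O z^-1).

(** A valuation ring is local: if y/x is in O, then x + y = x (1 + y/x), so an
    inverse of x + y in O would give one of x. *)
Let O_nonunitD x y : O_nonunit x -> O_nonunit y -> O_nonunit (x + y).
Proof.
move=> [Ox Mx] [Oy My]; split; first exact: subring_setD.
move=> xy0 Oxy.
wlog Oxy' : x y Ox Mx Oy My xy0 Oxy / O (y / x).
  move=> th; have [h|] := Oval (y / x); first exact: (th x y).
  by rewrite invf_div => h; apply: (th y x) => //; rewrite addrC.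
have [x0|x0] := eqVneq x 0.
  by move: xy0 Oxy; rewrite x0 add0r.
apply: (Mx (elimN eqP x0)).
have -> : x^-1 = (1 + y / x) * (x + y)^-1.
  by field; rewrite x0 andbT; apply/eqP.
by apply: subring_setM => //; apply: subring_setD => //; apply: subring_set1.
Qed.

Let O_nonunit_sum (I : Type) (r : seq I) (P : pred I) (f : I -> L) :
  (forall i, P i -> O_nonunit (f i)) -> O_nonunit (\sum_(i <- r | P i) f i).
Proof.
move=> Mf; apply: big_ind => [|x y|//]; last exact: O_nonunitD.
by split=> //; apply: subring_set0.
Qed.

Let max_term (I : eqType) (f : I -> L) (s : seq I) (i0 : I) :
  (forall i, i \in i0 :: s -> f i != 0) ->
  exists2 i, i \in i0 :: s & forall j, j \in i0 :: s -> O (f j / f i).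
Proof.
elim: s i0 => [|i1 s IH] i0 f0.
  exists i0 => [|j]; rewrite ?mem_head // inE => /eqP ->.
  by rewrite divff ?f0 ?mem_head //; apply: subring_set1.
have [|i is_ imax] := IH i1.
  by move=> i is_; apply: f0; rewrite inE is_ orbT.
have fi0 : f i != 0 by apply: f0; rewrite inE is_ orbT.
have f00 : f i0 != 0 by apply: f0; rewrite mem_head.
have [h|h] := Oval (f i0 / f i).
  exists i => [|j]; rewrite inE; first by rewrite is_ orbT.
  by case/predU1P=> [->|/imax].
exists i0 => [|j]; first exact: mem_head.
rewrite inE => /predU1P[->|/imax hj].
  by rewrite divff //; apply: subring_set1.
rewrite invf_div in h.
have -> : f j / f i0 = (f j / f i) * (f i / f i0) by rewrite mulrA divfK.
exact: subring_setM.
Qed.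

(** In a vanishing sum of nonzero elements, the term of least value cannot be
    unique: divided by it, the other terms would be non-units with sum -1. *)
Let two_terms (I : eqType) (f : I -> L) (s : seq I) (i0 : I) :
  uniq (i0 :: s) -> (forall i, i \in i0 :: s -> f i != 0) ->
  \sum_(i <- i0 :: s) f i = 0 ->
  exists i j, [/\ i \in i0 :: s, j \in i0 :: s, i != j & O_unit (f i / f j)].
Proof.
move=> us f0 sum0; have [i is_ imax] := max_term f0.
apply: contrapT => none.
have M j : j \in i0 :: s -> j != i -> O_nonunit (f j / f i).
  move=> js ji; split; first exact: imax.
  move=> _ h; apply: none; exists j, i; split=> //.
  by split=> //; apply: imax.
have : O_nonunit (- \sum_(j <- i0 :: s | j != i) f j / f i).
  rewrite -sumrN big_seq_cond; apply: O_nonunit_sum => j /andP[js ji].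
  have [Oj Nj] := M j js ji; split; first exact: subring_setN.
  move=> /eqP; rewrite oppr_eq0 => /eqP /Nj nj; rewrite invrN => h.
  by apply: nj; rewrite -[_^-1]opprK; apply: subring_setN.
have -> : - \sum_(j <- i0 :: s | j != i) f j / f i = 1.
  move: sum0; rewrite (bigD1_seq i) //= -mulr_suml => /eqP.
  by rewrite addr_eq0 => /eqP e; rewrite -mulNr -e divff ?f0.
case=> _ /(_ (elimN eqP (oner_neq0 _))); rewrite invr1; apply.
exact: subring_set1.
Qed.

Let pi0 : pi != 0.
Proof. by rewrite -(valy v) v_pi. Qed.
Let piL := pi%:A : L.
Let piL0 : piL != 0.
Proof. by rewrite /piL scaler_eq0 negb_or pi0 oner_neq0. Qed.

Let O_unit_alg (c : K) : v c = 0%E -> O_unit c%:A.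
Proof.
move=> vc; have c0 : c != 0 by rewrite -(valy v) vc.
have -> : c%:A = in_alg L c by [].
split; first by apply/OK; rewrite vc.
rewrite -fmorphV; apply/OK; rewrite valE ?invr_eq0 //.
by rewrite valV0 // vc oppr0.
Qed.

Let v_piz (k : int) : v (pi ^ k) = k%:E.
Proof.
by rewrite valE ?expfz_neq0 // valXz0 // v_pi /= -mulrzr intz mul1r.
Qed.

Let piLz (k : int) : piL ^ k = (pi ^ k)%:A.
Proof. by rewrite -in_algE fmorphXz. Qed.

Let O_piz (k : int) : O (piL ^ k) <-> 0 <= k.
Proof. by rewrite piLz OK v_piz lee_fin. Qed.

(** An algebraic equation of z over K has two terms of the same value, a_i z^i and
    a_j z^j, so z^(i - j) has the value of an element of K, hence of a power of
    the uniformizer. Here m is at most the degree of the equation. *)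
Lemma pow_unit (z : L) : z != 0 -> exists m (k : int),
  (0 < m <= \dim {:L}%VS)%N /\ O_unit (z ^+ m * piL ^ (- k)).
Proof.
move=> z0; have [p [p_mon p_size p_root]] := root_monic_dim z.
pose f i : L := (p`_i)%:A * z ^+ i.
pose s := [seq i <- iota 0 (size p) | p`_i != 0].
have f0 i : i \in s -> f i != 0.
  rewrite mem_filter => /andP[pi_n0 _].
  by rewrite mulf_neq0 ?expf_neq0 // scaler_eq0 negb_or pi_n0 oner_neq0.
have sum0 : \sum_(i <- s) f i = 0.
  move/rootP: p_root => e; rewrite -[RHS]e horner_coef size_map_poly big_filter.
  rewrite -(big_mkord xpredT (fun i => (map_poly (in_alg L) p)`_i * z ^+ i)).
  rewrite /index_iota subn0 big_mkcond.
  apply: eq_bigr => i _; rewrite coef_map /= /f; case: eqVneq => //= ->.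
  by rewrite scale0r mul0r.
have us : uniq s by rewrite filter_uniq ?iota_uniq.
have [i0 [s' sE]] : exists i0 s', s = i0 :: s'.
  have : (size p).-1 \in s.
    rewrite mem_filter -lead_coefE (monicP p_mon) oner_neq0 mem_iota /=.
    by rewrite prednK // size_poly_gt0 monic_neq0.
  by case: s {f0 sum0 us} => // i0 s' _; exists i0, s'.
rewrite sE in us f0 sum0.
have [i [j [is_ js ij uij]]] := two_terms us f0 sum0.
wlog ji : i j is_ js ij uij / (j < i)%N.
  move=> th; have [h|h|h] := ltngtP i j; last by rewrite h eqxx in ij.
    apply: (th j i) => //; first by rewrite eq_sym.
    by rewrite -invf_div; apply: O_unitV.
  exact: (th i j).
rewrite -sE !mem_filter !mem_iota /= add0n in is_ js.
have [/andP[pi_n0 isz] /andP[pj_n0 _]] := (is_, js).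
pose c := p`_i / p`_j.
have c0 : c != 0 by rewrite mulf_neq0 ?invr_eq0.
have [g vc] := val_fin v c0.
exists (i - j)%N, (- g); split.
  rewrite subn_gt0 ji /= (leq_trans (leq_subr _ _)) // -ltnS.
  exact: leq_trans isz p_size.
have Uc : O_unit (c * pi ^ (- g))%:A.
  apply: O_unit_alg; rewrite Defs.valM vc v_piz -EFinD.
  by rewrite subrr.
suff -> : z ^+ (i - j) * piL ^ (- - g) = (f i / f j) * ((c * pi ^ (- g))%:A)^-1.
  by apply: O_unitM => //; apply: O_unitV.
have zE : z ^+ i = z ^+ (i - j) * z ^+ j by rewrite -exprD subnK // ltnW.
have gE : (c * pi ^ (- g))%:A = c%:A * piL ^ (- g).
  by rewrite piLz -(rmorphM (in_alg L)).
have cE : c%:A = (p`_i)%:A / (p`_j)%:A :> L by rewrite -(fmorph_div (in_alg L)).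
have [pi_n0' pj_n0'] : (p`_i)%:A != 0 :> L /\ (p`_j)%:A != 0 :> L.
  by rewrite !scaler_eq0 !oner_eq0 !orbF.
have Q0 : piL ^ (- g) != 0 by rewrite expfz_neq0.
have zj0 : z ^+ j != 0 by rewrite expf_neq0.
rewrite -invr_expz gE cE /f zE; set Q := piL ^ _ in Q0 *.
move: (_%:A) (_%:A) pi_n0' pj_n0' => a b a0 b0.
by field; rewrite Q0 zj0 a0 b0.
Qed.

(** A valuation extending v must take the value k/m at z if z^m is pi^k up to
    a unit. *)
Let value_of (z : L) (q : rat) :=
  exists m (k : int), O_unit (z ^+ m.+1 * piL ^ (- k)) /\ q = k%:~R / m.+1%:R.

Let value_exists z : z != 0 -> exists q, value_of z q.
Proof.
move=> /pow_unit[[|m] [k [// _ U]]].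
by exists (k%:~R / m.+1%:R), m, k.
Qed.

Let value_mul x y q r : x != 0 -> y != 0 ->
  value_of x q -> value_of y r -> value_of (x * y) (q + r).
Proof.
move=> x0 y0 [m [k [Ux ->]]] [m' [k' [Uy ->]]].
exists (m.+1 * m'.+1).-1, (k * m'.+1%:Z + k' * m.+1%:Z); split; last first.
  have [a0 b0] : m.+1%:R != 0 :> rat /\ m'.+1%:R != 0 :> rat.
    by rewrite !pnatr_eq0.
  rewrite prednK ?muln_gt0 // natrM rmorphD !rmorphM /= -!pmulrn.
  by field; rewrite !nat1r a0 b0.
rewrite prednK ?muln_gt0 //.
suff -> : (x * y) ^+ (m.+1 * m'.+1) * piL ^ (- (k * m'.+1%:Z + k' * m.+1%:Z))
    = (x ^+ m.+1 * piL ^ (- k)) ^+ m'.+1 * (y ^+ m'.+1 * piL ^ (- k')) ^+ m.+1.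
  by apply: O_unitM; apply: O_unitX.
rewrite opprD expfzDr // -!mulNr -!exprz_exp -!exprnP !exprMn -!exprM.
by rewrite (mulnC m'.+1) mulrACA.
Qed.

Let value_inv x q : value_of x q -> value_of x^-1 (- q).
Proof.
move=> [m [k [U ->]]]; exists m, (- k); split; last by rewrite rmorphN mulNr.
by have := O_unitV U; rewrite invfM exprVn invr_expz.
Qed.

Let value_ge0 x q : x != 0 -> value_of x q -> O x <-> 0 <= q.
Proof.
move=> x0 [m [k [[U U'] ->]]].
have p0 : piL ^ k != 0 by rewrite expfz_neq0.
have xm0 : x ^+ m.+1 != 0 by rewrite expf_neq0.
rewrite pmulr_lge0 ?invr_gt0 ?ltr0n // ler0z -invr_expz in U U' *.
split=> [Ox|/O_piz Op].
  apply/O_piz; have -> : piL ^ k = x ^+ m.+1 * (x ^+ m.+1 / piL ^ k)^-1.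
    by rewrite invf_div mulrCA divff ?mulr1.
  by apply: subring_setM => //; apply: subring_setX.
have Oxm : O (x ^+ m.+1) by rewrite -(divfK p0 (x ^+ m.+1)); apply: subring_setM.
have [//|Ox'] := Oval x.
have -> : x = x ^+ m.+1 * x^-1 ^+ m by rewrite exprS exprVn mulfK ?expf_neq0.
by apply: subring_setM => //; apply: subring_setX.
Qed.

Let value_uniq x q r : x != 0 -> value_of x q -> value_of x r -> q = r.
Proof.
move=> x0; wlog suff th : q r / value_of x q -> value_of x r -> q <= r.
  by move=> xq xr; apply/le_anti; rewrite !th.
move=> xq xr; rewrite -subr_ge0 addrC.
have x1 : x^-1 != 0 by rewrite invr_eq0.
have h := value_mul x1 x0 (value_inv xq) xr.
apply/(value_ge0 (mulf_neq0 x1 x0) h).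
by rewrite mulVf //; apply: subring_set1.
Qed.

Let val_rat (x : L) : rat := xget 0 (value_of x).

Let val_ratP x : x != 0 -> value_of x (val_rat x).
Proof. by move=> /value_exists[q xq]; rewrite /val_rat; case: xgetP => // /(_ q). Qed.

Let val_ratE x q : x != 0 -> value_of x q -> val_rat x = q.
Proof. by move=> x0; apply: value_uniq => //; apply: val_ratP. Qed.

Let val_ext (x : L) : \bar rat := if x == 0 then +oo%E else (val_rat x)%:E.

Let val_ext_ge0 x : O x <-> (0 <= val_ext x)%E.
Proof.
rewrite /val_ext; case: eqVneq => [->|x0].
  by rewrite leey; split=> // _; apply: subring_set0.
by rewrite lee_fin; apply: value_ge0 => //; apply: val_ratP.
Qed.

Let val_extM x y : val_ext (x * y) = (val_ext x + val_ext y)%E.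
Proof.
rewrite /val_ext mulf_eq0; have [->|x0] := eqVneq x 0; first by case: eqVneq.
have [->|y0] //= := eqVneq y 0; rewrite -EFinD; congr (_%:E).
by apply: val_ratE; rewrite ?mulf_neq0 //; apply: value_mul => //; apply: val_ratP.
Qed.

Let val_ext_min x y : (Order.min (val_ext x) (val_ext y) <= val_ext (x + y)%R)%E.
Proof.
rewrite ge_min; wlog: x y / O (y / x).
  move=> th; have [/th //|] := Oval (y / x).
  by rewrite invf_div addrC orbC => /th.
have [->|x0 Oyx] := eqVneq x 0; first by rewrite add0r lexx orbT.
have -> : x + y = x * (1 + y / x) by rewrite mulrDr mulr1 mulrCA divff ?mulr1.
rewrite val_extM leeDl //; apply/val_ext_ge0.
by apply: subring_setD => //; apply: subring_set1.
Qed.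

(** Existence and uniqueness of the q in [value_of] define the valuation; its
    ultrametric inequality is the closure of O under addition, after division by
    the term of least value. *)
Lemma valuation_of_subring : exists2 u : valuation L rat, extends v u
  & forall z, O z <-> (0 <= u z)%E.
Proof.
have val_ext_Ny x : val_ext x != -oo%E by rewrite /val_ext; case: (x == 0).
have val_ext_y x : (val_ext x == +oo%E) = (x == 0) by rewrite /val_ext; case: (x == 0).
exists (Valuation val_ext_Ny val_ext_y val_extM val_ext_min) => // c /=.
have [->|c0] := eqVneq c 0; first by rewrite val0 scale0r /val_ext eqxx.
have [g vc] := val_fin v c0.
have cL0 : c%:A != 0 :> L by rewrite scaler_eq0 negb_or c0 oner_neq0.
rewrite /val_ext (negPf cL0) vc /=; congr (_%:E); apply: val_ratE => //.
exists 0%N, g; split; last by rewrite divr1.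
have -> : c%:A ^+ 1 * piL ^ (- g) = (c * pi ^ (- g))%:A :> L.
  by rewrite piLz -(rmorphM (in_alg L)).
by apply: O_unit_alg; rewrite Defs.valM vc v_piz -EFinD subrr.
Qed.

End ValuationSubring.
End ValuationSubringsOfExtensions.

(** * Integral elements and extensions of the valuation *)

Section IntegralElements.
Variables (K : fieldType) (L : fieldExtType K) (v : valuation K int).

Lemma integral_val_ge0 (w : valuation L rat) x :
  extends v w -> integral v x -> (0 <= w x)%E.
Proof.
move=> vw [p p_mon p_root].
have p_mon' : map_poly (in_alg L \o val) p \is monic by apply: monic_map.
apply: (val_root_monic p_mon') => [i|]; last exact: p_root.
by rewrite coef_map; apply: (vring_ext vw).
Qed.

Lemma integralOver_eqn (A : nzRingType) (phi : {rmorphism A -> L}) (x : L) m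
    (a : nat -> A) :
  x ^+ m = \sum_(j < m) phi (a j) * x ^+ j -> integralOver phi x.
Proof.
move=> xm; exists ('X^m - \poly_(j < m) a j).
  apply/monicP; rewrite lead_coefDl ?lead_coefXn // size_polyXn size_polyN.
  by rewrite ltnS size_poly.
apply/rootP; rewrite rmorphB /= map_polyXn hornerD hornerN hornerXn xm.
rewrite (horner_coef_wide (n := m)); last first.
  by apply: leq_trans (size_poly _ _) _; rewrite size_poly.
apply/eqP; rewrite subr_eq0; apply/eqP; apply: eq_bigr => j _.
by rewrite coef_map coef_poly ltn_ord.
Qed.

Lemma integral_of_eqn (x : L) m (a : nat -> valuation_ring v) :
  x ^+ m = \sum_(j < m) (val (a j))%:A * x ^+ j -> integral v x.
Proof. exact: (integralOver_eqn (phi := in_alg L \o val)). Qed.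

Variables (pi : K) (v_pi : v pi = 1%:E).

(** If x is not integral, then x is not in A[1/x], since x = p(1/x) becomes
    an integral equation after multiplication by a power of x. A maximal subring R
    containing A[1/x] and avoiding x is a valuation ring. It meets K in A: otherwise
    it would contain K, and then an equation of x over K would express x through
    1/x, which is in R. *)
Lemma not_integral_ext (x : L) : ~ integral v x ->
  exists2 u : valuation L rat, extends v u & (u x < 0)%E.
Proof.
move=> xnint.
have x0 : x != 0.
  apply/eqP => x0; apply: xnint; apply: (integral_of_eqn (m := 1) (a := fun=> 0)).
  by rewrite x0 expr1 big_ord1 rmorph0 scale0r mul0r.
pose A0 : set L := [set z | exists a : valuation_ring v, z = (val a)%:A]%classic.
have A0ring : subring_set A0.
  split=> [|_ _ [a ->] [b ->]|_ _ [a ->] [b ->]].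
  - by exists 1; rewrite rmorph1 scale1r.
  - by exists (a - b); rewrite rmorphB scalerBl.
  - by exists (a * b); rewrite -[(val a)%:A]in_algE -[(val b)%:A]in_algE -rmorphM.
have A0x : ~ adjoin_set A0 x^-1 x.
  case=> p A0p xE; apply: xnint.
  have [a aE] := choice A0p.
  (* Multiplying x = p(1/x) by a power of x reverses the order of the
     coefficients. *)
  apply: (integral_of_eqn (m := (size p).+1) (a := fun j => a (size p - j)%N)).
  rewrite exprSr {2}xE (horner_coef_wide (n := (size p).+1)) // mulr_sumr.
  rewrite (reindex_inj rev_ord_inj); apply: eq_bigr => j _ /=.
  rewrite aE subSS mulrCA exprVn; congr (_ * _).
  have -> : x ^+ size p = x ^+ j * x ^+ (size p - j).
    by rewrite -exprD subnKC // -ltnS.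
  by rewrite mulfK ?expf_neq0.
have [R [Rring A0R Rx Rmax]] :=
  max_subring_avoiding (subring_adjoin A0ring x^-1) A0x.
have Rx' : R x^-1 by apply: A0R; apply: adjoin_gen.
have Rval := max_subring_valuation Rring Rx' Rx Rmax.
have RA (c : K) : (0 <= v c)%E -> R c%:A.
  move=> vc; apply: A0R; apply: adjoin_sub => //.
  by exists (exist _ c vc).
have RK (c : K) : R c%:A <-> (0 <= v c)%E.
  split=> [Rc|]; last exact: RA.
  rewrite leNgt; apply/negP => vc; apply: Rx.
  have c0 := val_lt0_neq0 vc.
  (* A power of the element c of negative value absorbs any value of d. *)
  have KR (d : K) : R d%:A.
    have [->|d0] := eqVneq d 0; first by rewrite scale0r; apply: subring_set0.
    pose j := `|fine (v d)|%N.
    have -> : d = d / c ^+ j * c ^+ j by rewrite divfK ?expf_neq0.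
    rewrite -in_algE rmorphM rmorphXn; apply: subring_setM => //; last exact: subring_setX.
    apply: RA; rewrite valE ?mulf_neq0 ?invr_eq0 ?expf_neq0 // lee_fin.
    rewrite valM0 ?invr_eq0 ?expf_neq0 // valV0 ?expf_neq0 // valX0 //.
    move: vc; rewrite valE // lte_fin /j subr_ge0 -mulr_natr natz.
    move: (fine (v c)) (fine (v d)) => g h g0.
    apply: (@le_trans _ _ (- `|h|%N%:Z)); last by clear; lia.
    by rewrite -mulN1r ler_wpM2r //; move: g0; clear; lia.
  have [p [p_mon _ /rootP]] := root_monic_dim x.
  rewrite horner_coef size_map_poly.
  case sp : (size p) => [|m].
    by move: (monic_neq0 p_mon); rewrite -size_poly_eq0 sp.
  have pm : p`_m = 1 by rewrite -(monicP p_mon) lead_coefE sp.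
  rewrite big_ord_recr /= coef_map /= pm scale1r mul1r => /eqP; rewrite addrC addr_eq0 => /eqP xm.
  case: m => [|m] in sp pm xm.
    by move: xm; rewrite big_ord0 oppr0 expr0 => /eqP; rewrite oner_eq0.
  have -> : x = x ^+ m.+1 * x^-1 ^+ m by rewrite exprS exprVn mulfK ?expf_neq0.
  rewrite xm mulNr mulr_suml; apply: subring_setN => //; apply: subring_set_sum => // i _.
  have -> : x^-1 ^+ m = x^-1 ^+ i * x^-1 ^+ (m - i).
    by rewrite -exprD subnKC // -ltnS.
  rewrite mulrA -[X in X * _]mulrA -exprMn divff // expr1n mulr1 coef_map.
  by apply: subring_setM => //; [apply: KR | apply: subring_setX].
have [u vu Ru] := valuation_of_subring v_pi Rring Rval RK.
by exists u => //; rewrite ltNge; apply/negP => /Ru.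
Qed.

End IntegralElements.

(** * Ramification index and value group *)

Section RamificationIndex.
Variables (K : fieldType) (L : fieldExtType K) (v : valuation K int).
Variables (pi : K) (v_pi : v pi = 1%:E).
Variables (w : valuation L rat) (vw : extends v w).

Lemma vring_set_subring : subring_set [set x | x \in vring w]%classic.
Proof.
split=> /= [|x y|x y]; [exact: rpred1 | exact: rpredB | exact: rpredM].
Qed.

Lemma fine_val_alg (c : K) : fine (w c%:A) = (fine (v c))%:~R.
Proof. by rewrite vw; case: (v c). Qed.

(** The exponent m of [pow_unit] is at most the degree of L over K, so it divides
    its factorial. *)
Lemma value_bounded_denom (q : rat) : value_group w q ->
  exists k : int, q *+ (\dim {:L}%VS)`! = k%:~R.
Proof.
move=> [z z0 wz].
have Oval x : x \in vring w \/ x^-1 \in vring w.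
  have [->|x0] := eqVneq x 0; first by left; apply: rpred0.
  have x0' : x^-1 != 0 by rewrite invr_eq0.
  rewrite !unfold_in /vring (valE w x0) (valE w x0') !lee_fin valV0 // oppr_ge0.
  by apply/orP; apply: le_total.
have OK (c : K) : c%:A \in vring w <-> (0 <= v c)%E.
  rewrite unfold_in /vring vw; case: (v c) => [g||] //=.
  by rewrite !lee_fin ler0z.
have [m [k [/andP[m0 mn] [U U']]]] := pow_unit v_pi vring_set_subring Oval OK z0.
have pi0 : pi%:A != 0 :> L.
  by rewrite scaler_eq0 negb_or oner_neq0 -(valy v) v_pi.
have /eqP : q *+ m - k%:~R == 0.
  have e : fine (w (z ^+ m * pi%:A ^ (- k))) = q *+ m - k%:~R.
    rewrite valM0 ?expf_neq0 ?expfz_neq0 // valX0 // valXz0 // wz fine_val_alg v_pi /=.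
    by rewrite mulrNz.
  have u0 : z ^+ m * pi%:A ^ (- k) != 0 by rewrite mulf_neq0 ?expf_neq0 ?expfz_neq0.
  have u0' : (z ^+ m * pi%:A ^ (- k))^-1 != 0 by rewrite invr_eq0.
  move: U U'; rewrite /= !unfold_in /vring (valE w u0) (valE w u0') valV0 // e.
  rewrite !lee_fin oppr_ge0 => a b.
  by apply/eqP/le_anti; rewrite a b.
move/eqP; rewrite subr_eq0 => /eqP qm.
have /dvdnP[d ->] : (m %| (\dim {:L}%VS)`!)%N by rewrite dvdn_fact // m0.
by exists (k * d%:Z); rewrite mulnC mulrnA qm rmorphM /= -pmulrn mulr_natr.
Qed.

Lemma value_groupD q r : value_group w q -> value_group w r -> value_group w (q + r).
Proof.
move=> [x x0 wx] [y y0 wy]; exists (x * y); first by rewrite mulf_neq0.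
by rewrite Defs.valM wx wy.
Qed.

Lemma value_groupN q : value_group w q -> value_group w (- q).
Proof.
move=> [x x0 wx]; exists x^-1; first by rewrite invr_eq0.
by rewrite valE ?invr_eq0 // valV0 // wx.
Qed.

Lemma value_group_int (k : int) : value_group w k%:~R.
Proof.
have pi0 : pi != 0 by rewrite -(valy v) v_pi.
exists (pi ^ k)%:A; first by rewrite scaler_eq0 negb_or oner_neq0 expfz_neq0.
by rewrite vw (valE v) ?expfz_neq0 // valXz0 // v_pi /= -mulrzr intz mul1r.
Qed.

Lemma value_groupM q (k : int) : value_group w q -> value_group w (q *~ k).
Proof.
move=> [x x0 wx]; exists (x ^ k); first by rewrite expfz_neq0.
by rewrite valE ?expfz_neq0 // valXz0 // wx.
Qed.

(** A subgroup of the rationals with bounded denominators is cyclic, generated by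
    its least positive element, and it contains 1, so that element is 1/e. *)
Lemma value_group_cyclic : exists2 e, (0 < e)%N &
  forall q, value_group w q <-> exists m : int, q = e%:R^-1 * m%:~R.
Proof.
set N := (\dim {:L}%VS)`!; have N0 : (0 < N)%N by apply: fact_gt0.
have NQ : N%:R != 0 :> rat by rewrite pnatr_eq0 -lt0n.
pose H (h : nat) := (0 < h)%N && `[< value_group w (h%:R / N%:R) >].
have HN : H N.
  by rewrite /H N0 divff //=; apply/asboolP; apply: (value_group_int 1).
have [h /andP[h0 /asboolP hG] hmin] := @ex_minnP H (ex_intro _ N HN).
have div q : value_group w q -> exists m : int, q = m%:~R * (h%:R / N%:R).
  move=> qG; have [z qz] := value_bounded_denom qG.
  have qE : q = z%:~R / N%:R by rewrite -qz -[q *+ _]mulr_natr mulfK.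
  exists (z %/ h)%Z.
  have rG : value_group w ((z %% h)%Z%:~R / N%:R).
    have -> : (z %% h)%Z%:~R / N%:R = q - (h%:R / N%:R) *~ (z %/ h)%Z.
      have zE : z%:~R = (z %/ h)%Z%:~R * h%:R + (z %% h)%Z%:~R :> rat.
        by rewrite {1}(divz_eq z h) intrD intrM.
      by rewrite qE zE -[(_ / _) *~ _]mulrzr; field.
    by apply: value_groupD => //; apply/value_groupN/value_groupM.
  suff r0 : (z %% h)%Z = 0.
    by rewrite qE {1}(divz_eq z h) r0 addr0 intrM /= -pmulrn mulrA.
  have hz : 0 < h%:Z by rewrite ltz_nat.
  have := ltz_pmod z hz; have := modz_ge0 z (lt0r_neq0 hz).
  case: (z %% h)%Z rG => [[|r] rG|] // _; rewrite ltz_nat => rh.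
  suff : (h <= r.+1)%N by rewrite leqNgt rh.
  by apply: hmin; rewrite /H /=; apply/asboolP; rewrite pmulrn.
have hQ : h%:R != 0 :> rat by rewrite pnatr_eq0 -lt0n.
have [k kE] := div _ (value_group_int 1).
have := congr1 ( *%R^~ N%:R) kE; rewrite /= mulrA divfK // => E.
have {E} hk : N%:Z = k * h%:Z.
  by apply: (@intr_inj rat); rewrite rmorphM /= -!pmulrn -E mul1r.
case: k hk {kE} => k hk; last first.
  by exfalso; move: hk h0 N0; clear; nia.
have {hk} NE : N = (k * h)%N by apply/eqP; rewrite -eqz_nat PoszM hk.
have k0 : (0 < k)%N by move: N0; rewrite NE muln_gt0 => /andP[].
have kQ : k%:R != 0 :> rat by rewrite pnatr_eq0 -lt0n.
have hN : h%:R / N%:R = k%:R^-1 :> rat.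
  by rewrite NE natrM; field; rewrite hQ kQ.
exists k => // q; rewrite -hN; split=> [/div[m ->]|[m ->]].
  by exists m; rewrite mulrC.
by rewrite mulrzr; apply: value_groupM.
Qed.

Lemma base_value_groupE : base_value_group v = [set q | exists z : int, q = z%:~R]%classic.
Proof.
apply/seteqP; split=> [q [x x0]|q [z ->]].
  by rewrite (valE v x0) => -[<-]; exists (fine (v x)).
have pi0 : pi != 0 by rewrite -(valy v) v_pi.
exists (pi ^ z); first by rewrite expfz_neq0.
by rewrite (valE v) ?expfz_neq0 // valXz0 // v_pi /= -mulrzr intz mul1r.
Qed.

(** The cosets of Z in e^-1 Z are represented by the r/e with r < e, so the index
    is the e of [value_group_cyclic]. *)
Lemma value_groupE q :
  value_group w q <-> exists m : int, q = (ramification_index v w)%:R^-1 * m%:~R.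
Proof.
have [e e0 Ge] := value_group_cyclic.
suff -> : ramification_index v w = e by apply: Ge.
have eQ : e%:R != 0 :> rat by rewrite pnatr_eq0 -lt0n.
rewrite /ramification_index base_value_groupE; apply: card_fset_set.
pose coset (q : rat) := [set q + h | h in [set q | exists z : int, q = z%:~R]]%classic.
rewrite -[X in (X #= _)%card]/(coset @` value_group w)%classic.
have -> : (coset @` value_group w = (fun r : nat => coset (e%:R^-1 * r%:R)) @` `I_e)%classic.
  apply/seteqP; split=> [_ [_ /Ge[m ->] <-]|_ [r re <-]]; last first.
    by exists (e%:R^-1 * r%:R) => //; apply/Ge; exists r.
  have ez : 0 < e%:Z by rewrite ltz_nat.
  have := ltz_pmod m ez; have := modz_ge0 m (lt0r_neq0 ez).
  case mE : (m %% e)%Z => [r|] // _; rewrite ltz_nat => re.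
  have mQ : m%:~R = (m %/ e)%Z%:~R * e%:R + r%:R :> rat.
    by rewrite {1}(divz_eq m e) mE intrD intrM.
  exists r => //; apply/seteqP; split=> _ [_ [z ->] <-].
    exists (z - (m %/ e)%Z)%:~R; first by exists (z - (m %/ e)%Z).
    by rewrite mQ intrB; field.
  exists (z + (m %/ e)%Z)%:~R; first by exists (z + (m %/ e)%Z).
  by rewrite mQ intrD; field.
apply: inj_card_eq => r s /set_mem /= re /set_mem /= se rs.
have : coset (e%:R^-1 * r%:R) (e%:R^-1 * r%:R).
  by exists 0; [exists 0 | rewrite addr0].
rewrite rs => -[_ [z ->]] /(congr1 ( *%R e%:R)).
rewrite mulrDr !mulrA mulfV // !mul1r => /eqP.
rewrite !pmulrn -rmorphM -rmorphD /= eqr_int => /eqP E.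
have z0 : z = 0 by move: re se E; clear; nia.
by move: E; rewrite z0; clear; lia.
Qed.


End RamificationIndex.

(** * Weak approximation *)

Section WeakApproximation.
Variables (K : fieldType) (L : fieldExtType K) (v : valuation K int).
Variables (pi : K) (v_pi : v pi = 1%:E).
Variables (t : nat) (w : 'I_t -> valuation L rat).
Hypothesis vw : forall i, extends v (w i).
Hypothesis w_inj : forall i j, w i =1 w j -> i = j.

Let piL := pi%:A : L.

Let w_pi i : w i piL = 1%:E.
Proof. by rewrite vw v_pi. Qed.

Let piL0 : piL != 0.
Proof.
by rewrite scaler_eq0 negb_or oner_neq0 -(valy v) v_pi.
Qed.

(** Inclusion of one valuation ring in the other forces equality of the
    valuations: if w_i(x) = k/m, then x^m / pi^k is a unit for w_i, hence for w_j,
    and w_j(x) = k/m. *)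
Lemma incomparable i j : i != j -> exists x, (0 <= w i x)%E /\ (w j x < 0)%E.
Proof.
move=> ij; apply: contrapT => none.
have sub x : (0 <= w i x)%E -> (0 <= w j x)%E.
  by move=> wx; rewrite leNgt; apply/negP => wx'; apply: none; exists x.
suff wij : w i =1 w j by move: ij; rewrite (w_inj wij) eqxx.
move=> x; have [->|x0] := eqVneq x 0; first by rewrite !val0.
set q := fine (w i x); pose d := `|denq q|%N.
have d0 : (0 < d)%N by rewrite /d absz_gt0 denq_neq0.
pose y := x ^+ d * piL ^ (- numq q).
have y0 : y != 0 by rewrite mulf_neq0 ?expf_neq0 ?expfz_neq0.
have y0' : y^-1 != 0 by rewrite invr_eq0.
have wy k : fine (w k y) = fine (w k x) *+ d - (numq q)%:~R.
  by rewrite valM0 ?expf_neq0 ?expfz_neq0 // valX0 // valXz0 // w_pi /= mulrNz.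
have dq : q *+ d = (numq q)%:~R.
  by rewrite -mulr_natr /d -[LHS]/(q * _) pmulrn gez0_abs ?denq_ge0 // -numqE.
have wiy : fine (w i y) = 0 by rewrite wy dq subrr.
have := sub y^-1; have := sub y.
rewrite (valE (w i) y0) (valE (w j) y0) (valE (w i) y0') (valE (w j) y0').
rewrite !valV0 // wiy oppr0 lexx => /(_ isT) a /(_ isT) b.
have /eqP : fine (w j y) == 0.
  by move: a b; rewrite !lee_fin oppr_ge0 => a b; apply/eqP/le_anti; rewrite a b.
rewrite wy -dq => /eqP; rewrite subr_eq0 => /eqP.
rewrite -[fine (w j x) *+ _]mulr_natr -[q *+ _]mulr_natr => /(mulIf _) e.
by rewrite (valE _ x0) (valE (w j) x0) e // pnatr_eq0 -lt0n.
Qed.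

(** Two elements that witness incomparability in the two directions have a
    quotient of strictly opposite signs. *)
Lemma separate2 i j : i != j -> exists x, (w i x < 0)%E /\ (0 < w j x)%E.
Proof.
move=> ij; have [x [wix wjx]] := incomparable ij.
rewrite eq_sym in ij; have [y [wjy wiy]] := incomparable ij.
have [x0 y0] := (val_lt0_neq0 wjx, val_lt0_neq0 wiy).
have yx0 : y / x != 0 by rewrite mulf_neq0 ?invr_eq0.
exists (y / x); rewrite (valE (w i) yx0) (valE (w j) yx0) !valM0 ?invr_eq0 // !valV0 //.
move: wix wjx wjy wiy; rewrite (valE (w i) x0) (valE (w j) x0).
rewrite (valE (w i) y0) (valE (w j) y0) !lee_fin !lte_fin.
by split; lra.
Qed.

Lemma val_pow_mul_unbounded i x y (c : rat) : x != 0 -> y != 0 -> (0 < w i x)%E ->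
  exists r0, forall r, (r0 <= r)%N -> (c%:E < w i (x ^+ r * y)%R)%E.
Proof.
move=> x0 y0; rewrite (valE _ x0) lte_fin => wx.
set a := fine (w i x) in wx; set b := fine (w i y).
exists (Num.bound `|(c - b) / a|) => r rb.
rewrite valE ?mulf_neq0 ?expf_neq0 // lte_fin valM0 ?expf_neq0 // valX0 //.
rewrite -ltrBlDr -/a -/b -mulr_natl -ltr_pdivrMr //.
apply: le_lt_trans (ler_norm _) _; apply: lt_le_trans (archi_boundP (normr_ge0 _)) _.
by rewrite ler_nat.
Qed.

Lemma eventually_all (I : eqType) (s : seq I) (P : I -> nat -> Prop) :
  (forall i, i \in s -> exists r0, forall r, (r0 <= r)%N -> P i r) ->
  exists r0, forall r, (r0 <= r)%N -> forall i, i \in s -> P i r.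
Proof.
elim: s => [|i s IH] Ps; first by exists 0%N.
have [r0 Pr0] := IH (fun j js => Ps j (mem_behead (s := i :: s) js)).
have [r1 Pr1] := Ps i (mem_head i s).
exists (maxn r0 r1) => r; rewrite geq_max => /andP[r0r r1r] j.
by rewrite inE => /predU1P[->|]; [apply: Pr1 | apply: Pr0].
Qed.

(** Induction on s. Let x work for s, and let y separate i from the new index j.
    For large r, x^r y works unless w_j(x) < 0; in that case dividing it by
    1 + x^r cancels the effect of x^r at i and j, where x is negative, and changes
    nothing on s, where 1 + x^r is a unit. *)
Lemma separate i (s : seq 'I_t) : i \notin s ->
  exists x, (w i x < 0)%E /\ forall j, j \in s -> (0 < w j x)%E.
Proof.
elim: s => [|j s IH] is_.
  exists piL^-1; split=> //.
  by rewrite valE ?invr_eq0 // valV0 // w_pi lte_fin.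
move: is_; rewrite inE negb_or => /andP[ij /IH[x [wix wsx]]].
have [y [wiy wjy]] := separate2 ij.
have [x0 y0] := (val_lt0_neq0 wix, val_lt0_neq0 wiy).
have [r0 r0P] : exists r0, forall r, (r0 <= r)%N ->
    forall k, k \in s -> (0%:E < w k (x ^+ r * y)%R)%E.
  by apply: eventually_all => k ks; apply: val_pow_mul_unbounded => //; apply: wsx.
have wiX r z : z != 0 -> (w i z < 0)%E -> (w i (x ^+ r * z)%R < 0)%E.
  move=> z0; move: wix; rewrite (valE _ x0) (valE _ z0) !lte_fin => wx wz.
  rewrite valE ?mulf_neq0 ?expf_neq0 // lte_fin valM0 ?expf_neq0 // valX0 //.
  have : fine (w i x) *+ r <= 0 by rewrite mulrn_wle0 // ltW.
  by move: wz; lra.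
have [wjx|wjx] := leP 0%E (w j x).
  exists (x ^+ r0 * y); split; first exact: wiX.
  move=> k; rewrite inE => /predU1P[->|ks]; last exact: r0P.
  apply: lt_le_trans wjy _; rewrite Defs.valM leeDr //.
  by rewrite valE ?expf_neq0 // lee_fin valX0 // mulrn_wge0 // -lee_fin -valE.
have pow_neg k r : (w k x < 0)%E -> w k (1 + x ^+ r.+1) = w k (x ^+ r.+1).
  move=> wkx; rewrite addrC valD_lt // Defs.val1 valE ?expf_neq0 // valX0 //.
  by rewrite lte_fin mulrn_wlt0 // -lte_fin -valE.
have pow_pos k r : (0 < w k x)%E -> w k (1 + x ^+ r.+1) = 0%E.
  move=> wkx; rewrite valD_lt Defs.val1 // valE ?expf_neq0 // valX0 //.
  by rewrite lte_fin mulrn_wgt0 // -lte_fin -valE.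
set r := r0.+1; set D := 1 + x ^+ r.
have xr0 : x ^+ r != 0 by rewrite expf_neq0.
have D0 : D != 0.
  by rewrite -(valy (w i)) pow_neg // valE.
have u0 : x ^+ r * y / D != 0 by rewrite !mulf_neq0 ?invr_eq0.
have wu k : fine (w k (x ^+ r * y / D)) =
    fine (w k (x ^+ r)) + fine (w k y) - fine (w k D).
  by rewrite valM0 ?mulf_neq0 ?invr_eq0 // valM0 // valV0.
exists (x ^+ r * y / D); split.
  rewrite (valE _ u0) lte_fin wu pow_neg // addrAC subrr add0r.
  by rewrite -lte_fin -valE.
move=> k; rewrite inE => /predU1P[->|ks].
  rewrite (valE _ u0) lte_fin wu pow_neg // addrAC subrr add0r.
  by rewrite -lte_fin -valE.
rewrite (valE _ u0) lte_fin wu pow_pos ?wsx // subr0 -valM0 //.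
by rewrite -lte_fin -valE ?mulf_neq0 // r0P /r.
Qed.

(** With x from [separate], x^r / (1 + x^r) tends to 1 for w_i and to 0 for the
    other valuations as r grows. *)
Lemma near_idempotent i (M : rat) : exists e, (M%:E < w i (e - 1)%R)%E /\
  forall j, j != i -> (M%:E < w j e)%E.
Proof.
have [|x [wix wx]] := separate (i := i) (s := rem i (enum 'I_t)).
  by rewrite mem_rem_uniqF // enum_uniq.
have {}wx j : j != i -> (0 < w j x)%E.
  by move=> ji; apply: wx; rewrite mem_rem_uniq ?enum_uniq // !inE ji mem_enum.
have x0 := val_lt0_neq0 wix; have x0' : x^-1 != 0 by rewrite invr_eq0.
have wi' : (0 < w i (x^-1)%R)%E.
  by move: wix; rewrite (valE _ x0) (valE _ x0') !lte_fin valV0 // oppr_gt0.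
have [r1 r1P] := val_pow_mul_unbounded M x0' (oner_neq0 L) wi'.
have [r0 r0P] : exists r0, forall r, (r0 <= r)%N ->
    forall j, j \in [seq j <- enum 'I_t | j != i] -> (M%:E < w j (x ^+ r * 1)%R)%E.
  apply: eventually_all => j; rewrite mem_filter => /andP[ji _].
  by apply: val_pow_mul_unbounded => //; [rewrite oner_neq0 | apply: wx].
pose r := (maxn r0 r1).+1; pose D := 1 + x ^+ r.
have xr0 : x ^+ r != 0 by rewrite expf_neq0.
have wiD : w i D = w i (x ^+ r).
  rewrite /D addrC valD_lt // Defs.val1 valE // valX0 //.
  by rewrite lte_fin mulrn_wlt0 // -lte_fin -valE.
have wD j : j != i -> w j D = 0%E.
  move=> ji; rewrite valD_lt Defs.val1 // valE // valX0 //.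
  by rewrite lte_fin mulrn_wgt0 // -lte_fin -valE // wx.
have D0 : D != 0 by rewrite -(valy (w i)) wiD valE.
have D0' : D^-1 != 0 by rewrite invr_eq0.
exists (x ^+ r / D); split=> [|j ji].
  have -> : x ^+ r / D - 1 = - D^-1 by rewrite /D in D0 *; field.
  rewrite valN (valE _ D0') valV0 // wiD -valV0 // -exprVn -valE ?expf_neq0 //.
  by rewrite -[_ ^+ r]mulr1 r1P // leqW // leq_maxr.
have jin : j \in [seq j <- enum 'I_t | j != i] by rewrite mem_filter ji mem_enum.
rewrite valE ?mulf_neq0 // valM0 // valV0 // wD // subr0 -valE //.
by rewrite -[_ ^+ r]mulr1 r0P // leqW // leq_maxl.
Qed.

Theorem weak_approximation (a : 'I_t -> L) (M : rat) :
  exists x, forall i, (M%:E < w i (x - a i)%R)%E.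
Proof.
(* Large enough to compensate for every value of every target. *)
pose N := \sum_i \sum_j `|M - fine (w i (a j))|.
have NM i j : M - fine (w i (a j)) <= N.
  rewrite /N (bigD1 i) //= (bigD1 j) //= -addrA; apply: ler_wpDr; last exact: ler_norm.
  by apply: addr_ge0; do ?[apply: sumr_ge0 => ? _].
have [e eP] := choice (fun i => near_idempotent i N).
exists (\sum_j e j * a j) => i.
have -> : \sum_j e j * a j - a i = \sum_j (e j - (j == i)%:R) * a j.
  rewrite (eq_bigr _ (fun j _ => mulrBl _ _ _)) sumrB; congr (_ - _).
  rewrite (bigD1 i) //= eqxx mul1r big1 ?addr0 // => j /negPf ->.
  by rewrite mul0r.
apply: val_sum_gt => j _; have [->|aj0] := eqVneq (a j) 0.
  by rewrite mulr0 val0 ltry.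
have we : (N%:E < w i (e j - (j == i)%:R)%R)%E.
  have [eji ejk] := eP j.
  by case: eqVneq => [<-//|ji]; rewrite subr0; apply: ejk; rewrite eq_sym.
have [->|ej0] := eqVneq (e j - (j == i)%:R) 0; first by rewrite mul0r val0 ltry.
move: we; rewrite (valE _ ej0) (valE _ (mulf_neq0 ej0 aj0)) !lte_fin valM0 //.
by have := NM i j; lra.
Qed.

End WeakApproximation.

(** * Dimension of a product of vector spaces *)

Section DimensionCount.
Variable k : fieldType.

Lemma vector_axiom_of_basis (M : lmodType k) m (u : 'I_m -> M) :
  (forall y, exists c : 'I_m -> k, y = \sum_j c j *: u j) ->
  (forall c, \sum_j c j *: u j = 0 -> forall j, c j = 0) ->
  inhabited (Vector.axiom m M).
Proof.
move=> uspan ufree; have [c cE] := choice uspan.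
have uniq (r s : 'I_m -> k) :
    \sum_j r j *: u j = \sum_j s j *: u j -> forall j, r j = s j.
  move=> rs j; apply/eqP; rewrite -subr_eq0; apply/eqP.
  apply: (ufree (fun j => r j - s j)).
  by rewrite (eq_bigr _ (fun j _ => scalerBl _ _ _)) sumrB rs subrr.
constructor; exists (fun y => \row_j c y j) => [a x y|].
  apply/rowP => j; rewrite !mxE.
  apply: (uniq _ (fun j => a * c x j + c y j)).
  rewrite -cE (eq_bigr _ (fun j _ => scalerDl _ _ _)) big_split /= -cE.
  congr (_ + _); rewrite {1}(cE x) scaler_sumr.
  by apply: eq_bigr => j' _; rewrite scalerA.
exists (fun r : 'rV_m => \sum_j r 0 j *: u j) => [y|r].
  by rewrite [RHS]cE; apply: eq_bigr => j _; rewrite mxE.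
by apply/rowP => j; rewrite mxE; apply: (uniq _ (fun j => r 0 j)); rewrite -cE.
Qed.

(** A nontrivial relation allows one generator to be dropped, until the generators
    form a basis. *)
Lemma vector_axiom_of_span (M : lmodType k) m (u : 'I_m -> M) :
  (forall y, exists c : 'I_m -> k, y = \sum_j c j *: u j) ->
  exists d, inhabited (Vector.axiom d M).
Proof.
elim: m u => [|m IH] u uspan.
  by exists 0%N; apply: (vector_axiom_of_basis uspan) => c _ [].
have [ufree|] := pselect (forall c, \sum_j c j *: u j = 0 -> forall j, c j = 0).
  by exists m.+1; apply: vector_axiom_of_basis ufree.
move=> /existsNP[c] /not_implyP[c0 /existsNP[j0 /eqP cj0]].
apply: (IH (fun j => u (lift j0 j))) => y; have [b ->] := uspan y.
have uj0 : u j0 = \sum_j (- (c j0)^-1 * c (lift j0 j)) *: u (lift j0 j).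
  move: c0; rewrite (bigD1_ord j0) //= => /eqP; rewrite addr_eq0 => /eqP e.
  rewrite (eq_bigr (fun j => - (c j0)^-1 *: (c (lift j0 j) *: u (lift j0 j)))).
    by rewrite -scaler_sumr scaleNr -scalerN -e scalerA mulVf ?scale1r.
  by move=> j _; rewrite scalerA.
exists (fun j => b j0 * (- (c j0)^-1 * c (lift j0 j)) + b (lift j0 j)).
rewrite (bigD1_ord j0) //= {1}uj0 scaler_sumr -big_split /=.
by apply: eq_bigr => j _; rewrite scalerDl scalerA.
Qed.

Variables (t m : nat) (P : pred 'I_t) (M : 'I_t -> lmodType k).
Variable u : 'I_m -> forall i, M i.

(** The hypotheses say that the u j form a basis of the product of the M i with
    P i. Stacking coordinates gives a matrix whose row j is the image of u j; it has
    full row and column rank, hence as many rows as columns. *)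
Lemma card_product_basis (d : 'I_t -> nat) :
  (forall i, P i -> inhabited (Vector.axiom (d i) (M i))) ->
  (forall c : 'I_m -> k, (forall i, P i -> \sum_j c j *: u j i = 0) ->
     forall j, c j = 0) ->
  (forall y : forall i, M i, exists c : 'I_m -> k,
     forall i, P i -> \sum_j c j *: u j i = y i) ->
  m = (\sum_(i | P i) d i)%N.
Proof.
move=> iso ufree uspan.
(* Off P the width is 0, so that the columns can be indexed by all i. *)
have coord i : {q : nat & {g : {linear M i -> 'rV[k]_q} |
    if P i then q = d i /\ bijective g else q = 0%N}}.
  case Pi : (P i); last by exists 0%N, (\0 : {linear M i -> 'rV[k]_0}).
  have [f f_lin f_bij] := inhabited_witness (iso i Pi).
  pose F : {linear M i -> 'rV[k]_(d i)} := HB.pack f (GRing.isLinear.Build _ _ _ _ f f_lin).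
  by exists (d i), F.
pose q i := projT1 (coord i); pose g i : {linear M i -> 'rV_(q i)} := sval (projT2 (coord i)).
have gP i : if P i then q i = d i /\ bijective (g i) else q i = 0%N.
  exact: svalP (projT2 (coord i)).
pose B i : 'M[k]_(m, q i) := \matrix_(j, l) g i (u j i) 0 l.
have mulB i (c : 'rV_m) : c *m B i = g i (\sum_j c 0 j *: u j i).
  apply/rowP => l; rewrite linear_sum mxE summxE; apply: eq_bigr => j _.
  by rewrite linearZ !mxE.
have q0 i : ~~ P i -> q i = 0%N by have := gP i; case: (P i).
have nil0 i (x y : 'rV[k]_(q i)) : ~~ P i -> x = y.
  by move=> /q0 qi; apply/rowP => l; case: l => l lq; exfalso; rewrite qi in lq.
pose A := \mxrow_i B i.
have mA : \rank A = m.
  apply/eqP; apply: inj_row_free => c.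
  rewrite mul_mxrow -mxrow0 => /eq_mxrowP cB; apply/rowP => j; rewrite [RHS]mxE.
  apply: (ufree (fun j => c 0 j)) => i Pi.
  have := gP i; rewrite Pi => -[_ gbij]; apply: (bij_inj gbij).
  by rewrite -mulB cB linear0.
have qA : \rank A = (\sum_i q i)%N.
  apply/eqP; rewrite -[_ == _]/(row_full A) -sub1mx; apply/row_subP => l.
  set r := row l _.
  have lift_r i : exists y : M i, g i y = submxrow r i.
    have [Pi|nPi] := boolP (P i); last by exists 0; apply: nil0.
    have := gP i; rewrite Pi => -[_ [h _ gh]].
    by exists (h (submxrow r i)); rewrite gh.
  have [c cE] := uspan (fun i => sval (cid (lift_r i))); apply/submxP; exists (\row_j c j).
  apply/mxrowP => i; rewrite mul_mxrow mxrowK mulB -(svalP (cid (lift_r i))).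
  have [Pi|nPi] := boolP (P i); last exact: nil0.
  congr (g i _); rewrite -cE //; apply: eq_bigr => j _.
  by rewrite mxE.
rewrite -[LHS]mA qA [RHS]big_mkcond; apply: eq_bigr => i _.
by have := gP i; case: (P i) => [[]|].
Qed.

End DimensionCount.

(** * Residue classes and the minimum of the valuations *)

Section ResidueClass.
Variables (F : fieldType) (G : realDomainType) (w : valuation F G).

(** Total on F, with default class 0 outside the valuation ring, so that sums of
    residues can be formed without carrying proofs of membership. *)
Definition residue (x : F) : residue_field w :=
  \pi_(residue_field w)%qT (insubd (0 : valuation_ring w) x).

Lemma residueE (x : F) (wx : x \in vring w) :
  residue x = \pi_(residue_field w)%qT (exist _ x wx).
Proof. by congr (\pi_(residue_field w)%qT _); apply: val_inj; rewrite insubdK. Qed.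

Lemma residue_val (a : valuation_ring w) : residue (val a) = \pi_(residue_field w)%qT a.
Proof. by rewrite /residue valKd. Qed.

Lemma residue_surj (y : residue_field w) : exists2 x, x \in vring w & residue x = y.
Proof.
exists (val (repr y)); first exact: valP (repr y).
by rewrite residue_val reprK.
Qed.

Lemma residueD x y : x \in vring w -> y \in vring w ->
  residue (x + y) = residue x + residue y.
Proof.
move=> wx wy; rewrite (residueE wx) (residueE wy) (residueE (rpredD wx wy)) -piD.
by congr (\pi_(residue_field w)%qT _); apply: val_inj; rewrite rmorphD.
Qed.

Lemma residueM x y : x \in vring w -> y \in vring w ->
  residue (x * y) = residue x * residue y.
Proof.
move=> wx wy; rewrite (residueE wx) (residueE wy) (residueE (rpredM wx wy)) -piM.
by congr (\pi_(residue_field w)%qT _); apply: val_inj; rewrite rmorphM.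
Qed.

Lemma residue_eq x y : x \in vring w -> y \in vring w ->
  (residue x == residue y) = (0 < w (x - y)%R)%E.
Proof. by move=> wx wy; rewrite (residueE wx) (residueE wy) pi_eq unfold_in. Qed.

Lemma residue0 : residue 0 = 0.
Proof. by rewrite -pi0 -residue_val rmorph0. Qed.

Lemma residue_eq0 x : x \in vring w -> (residue x == 0) = (0 < w x)%E.
Proof. by move=> wx; rewrite -residue0 residue_eq ?rpred0 // subr0. Qed.

Lemma vringE x : (x \in vring w) = (0 <= w x)%E. Proof. by []. Qed.

End ResidueClass.

Section ResidueScale.
Variables (K : fieldType) (L : fieldExtType K) (v : valuation K int).
Variables (w : valuation L rat) (vw : extends v w).

Lemma vring_scale (a : K) x : a \in vring v -> x \in vring w -> a *: x \in vring w.
Proof.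
move=> va wx; rewrite -[x]mul1r scalerAl.
exact: rpredM (vring_ext vw (exist _ a va)) wx.
Qed.

Lemma residue_scaleE (a : K) (x : L) : a \in vring v -> x \in vring w ->
  residue v a *: (residue w x : residue_ext vw) = residue w (a *: x).
Proof.
move=> va wx; rewrite (residueE va).
rewrite -[LHS]/(residue_map vw (\pi_(residue_field v)%qT (exist _ a va)) * residue w x).
rewrite residue_mapE -residue_val /= -residueM ?mulr_algl //.
exact: (vring_ext vw (exist _ a va)).
Qed.

Lemma residue_sum (m : nat) (a : 'I_m -> K) (x : 'I_m -> L) :
  (forall j, a j \in vring v) -> (forall j, x j \in vring w) ->
  \sum_j residue v (a j) *: (residue w (x j) : residue_ext vw)
    = residue w (\sum_j a j *: x j).
Proof.
move=> va wx.
suff [] : (\sum_j residue v (a j) *: (residue w (x j) : residue_ext vw)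
    = residue w (\sum_j a j *: x j)) /\ \sum_j a j *: x j \in vring w by [].
pose R (p : residue_ext vw) q := p = residue w q /\ q \in vring w.
apply: (big_ind2 R) => [|p q p' q' [-> wq] [-> wq']|j _].
- by split; [rewrite residue0 | apply: rpred0].
- by split; [rewrite residueD | apply: rpredD].
by split; [apply: residue_scaleE | apply: vring_scale].
Qed.

End ResidueScale.

Section MinimumOfValuations.
Variables (K : fieldType) (L : fieldExtType K) (v : valuation K int).
Variables (t : nat) (w : 'I_t -> valuation L rat).
Hypothesis vw : forall i, extends v (w i).

Lemma wmin_le i x : (wmin w x <= w i x)%E.
Proof. exact: bigmin_le. Qed.

Lemma wmin_ge m x : (forall i, (m <= w i x)%E) -> (m <= wmin w x)%E.
Proof. by move=> mw; apply: le_bigmin => //; apply: leey. Qed.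

Lemma wmin_gt (m : rat) x : (forall i, (m%:E < w i x)%E) -> (m%:E < wmin w x)%E.
Proof. by move=> mw; apply: lt_bigmin => //; apply: ltry. Qed.

Lemma wmin_attained x : wmin w x = +oo%E \/ exists i, wmin w x = w i x.
Proof.
have : (wmin w x <= wmin w x)%E by [].
by case/bigmin_leP => [|[i _ wi]]; [rewrite leye_eq => /eqP; left |
  right; exists i; apply/le_anti; rewrite wi wmin_le].
Qed.

Lemma w_scale i (c : K) x : w i (c *: x) = (er_map intr (v c) + w i x)%E.
Proof. by rewrite -[x in LHS]mul1r scalerAl Defs.valM vw. Qed.

Lemma wmin_scale (c : K) x : wmin w (c *: x) = (er_map intr (v c) + wmin w x)%E.
Proof.
apply/le_anti/andP; split.
  have [->|[i ->]] := wmin_attained x; last by rewrite -w_scale wmin_le.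
  by have := valNy v c; case: (v c) => //= *; apply: leey.
by apply: wmin_ge => i; rewrite w_scale leeD2l // wmin_le.
Qed.

End MinimumOfValuations.

(** * Reduced integral bases *)

Section ReducedIntegralBasis.
Variables (K : fieldType) (L : fieldExtType K) (v : valuation K int).
Variables (pi : K) (v_pi : v pi = 1%:E).
Variables (t : nat) (w : 'I_t -> valuation L rat).
Hypothesis vw : forall i, extends v (w i).
Hypothesis w_inj : forall i j, w i =1 w j -> i = j.
Hypothesis w_all : forall u : valuation L rat, extends v u -> exists i, u =1 w i.
Variable S : {fset L}.
Hypothesis S_basis : integral_basis v S.
Hypothesis S_reduced : reduced w S.

Let pi0 : pi != 0. Proof. by rewrite -(valy v) v_pi. Qed.

(** A non-integral element is negative under some extension of v, and all
    extensions are among the w i. *)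
Lemma integralP x : integral v x <-> (0 <= wmin w x)%E.
Proof.
split=> [xint|wx]; first by apply: wmin_ge => i; apply: integral_val_ge0 xint.
apply: contrapT => /(not_integral_ext v_pi)[u vu].
have [i ->] := w_all vu; rewrite ltNge => /negP; apply.
exact: le_trans wx (wmin_le _ _ _).
Qed.

Lemma sum_indicator (s : L) (f : L -> K) : s \in S ->
  \sum_(z <- S) (if z == s then f z else 0) *: z = f s *: s.
Proof.
move=> sS; rewrite (bigD1_seq s) ?fset_uniq //= eqxx big1 ?addr0 // => z /negPf ->.
by rewrite scale0r.
Qed.

Lemma basis_wmin_ge0 s : s \in S -> (0 <= wmin w s)%E.
Proof.
move=> sS; apply/integralP/S_basis.1.
exists (fun z => if z == s then 1 else 0).
transitivity (\sum_(z <- S) (if z == s then 1 else 0 : K) *: z).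
  by rewrite (sum_indicator (fun=> 1)) // scale1r.
by apply: eq_bigr => z _; case: (z == s); rewrite ?rmorph1 ?rmorph0.
Qed.

(** Otherwise s / pi would be integral, and the coefficient of s in pi (s / pi)
    would be both 1 and a multiple of pi. *)
Lemma basis_wmin_lt1 s : s \in S -> (wmin w s < 1)%E.
Proof.
move=> sS; rewrite ltNge; apply/negP => ws.
have /integralP/S_basis.1[a aE] : (0 <= wmin w (pi^-1 *: s))%E.
  rewrite (wmin_scale vw) (valE v) ?invr_eq0 // valV0 // v_pi /=.
  by move: ws; case: (wmin w s) => [q||] //; rewrite -EFinD !lee_fin; lra.
have vpi : pi \in vring v by rewrite vringE v_pi.
pose piA : valuation_ring v := exist _ pi vpi.
pose b z : valuation_ring v := piA * a z - (if z == s then 1 else 0).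
have bE z : val (b z) = pi * val (a z) - (if z == s then 1 else 0).
  by rewrite rmorphB rmorphM; case: (z == s).
have /S_basis.2/(_ s sS) : \sum_(z <- S) val (b z) *: z = 0.
  rewrite (eq_bigr _ (fun z _ => congr1 ( *:%R^~ z) (bE z))).
  rewrite (eq_bigr _ (fun z _ => scalerBl _ _ _)) sumrB.
  rewrite (sum_indicator (fun=> 1)) // scale1r.
  rewrite (eq_bigr (fun z => pi *: (val (a z) *: z))) => [|z _]; last by rewrite scalerA.
  by rewrite -scaler_sumr -aE scalerA divff // scale1r subrr.
move/(congr1 val); rewrite bE eqxx rmorph0 => /eqP; rewrite subr_eq0 => /eqP e.
have := Defs.valM v pi (val (a s)); rewrite e Defs.val1 v_pi.
have := valP (a s); rewrite vringE.
by case: (v _) => [g||] //; rewrite lee_fin => g0 []; lia.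
Qed.

Lemma basis_wmin s : s \in S -> exists2 q : rat, wmin w s = q%:E & 0 <= q < 1.
Proof.
move=> sS; have := basis_wmin_ge0 sS; have := basis_wmin_lt1 sS.
by case: (wmin w s) => [q||] //; rewrite lee_fin lte_fin => q1 q0; exists q; rewrite ?q0.
Qed.

(** A multiple of x by a high power of pi is integral. *)
Lemma basis_span x : exists a : L -> K, x = \sum_(s <- S) a s *: s.
Proof.
have [->|x0] := eqVneq x 0.
  by exists (fun=> 0); rewrite big1 // => s _; rewrite scale0r.
have piL0 : pi%:A != 0 :> L by rewrite scaler_eq0 negb_or oner_neq0 pi0.
have [r rP] : exists r0, forall r, (r0 <= r)%N -> forall i, i \in enum 'I_t ->
    (0%:E < w i (pi%:A ^+ r * x)%R)%E.
  apply: eventually_all => i _; apply: val_pow_mul_unbounded => //.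
  by rewrite vw v_pi.
have /integralP/S_basis.1[a aE] : (0 <= wmin w (pi%:A ^+ r * x))%E.
  by apply: wmin_ge => i; apply/ltW/rP; rewrite ?mem_enum.
exists (fun s => (pi ^+ r)^-1 * val (a s)).
rewrite (eq_bigr _ (fun z _ => esym (scalerA _ _ _))) -scaler_sumr -aE.
have -> : pi%:A ^+ r = (pi ^+ r)%:A :> L by rewrite -!in_algE rmorphXn.
by rewrite mulr_algl scalerA mulVf ?scale1r // expf_neq0.
Qed.

Lemma bigmin_seq_le (f : L -> \bar rat) s : s \in S ->
  (\big[Order.min/+oo]_(z <- S) f z <= f s)%E.
Proof.
by move=> sS; rewrite (bigD1_seq s) ?fset_uniq //= ge_min lexx.
Qed.

Lemma wmin_sum_le (a : L -> K) s : s \in S ->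
  (wmin w (\sum_(z <- S) a z *: z) <= er_map intr (v (a s)) + wmin w s)%E.
Proof.
move=> sS; rewrite S_reduced.2 -(wmin_scale vw).
exact: (bigmin_seq_le (fun z => wmin w (a z *: z))).
Qed.

Variable delta : rat.
Hypothesis delta_val : unit_interval_values w delta.

Let I := index_set v w delta.
Let Sd := [seq s <- S | wmin w s == delta%:E].

Lemma index_setP i : (i \in I) <-> value_group (w i) delta.
Proof.
rewrite inE; split=> [/asboolP|]; first by move/(value_groupE v_pi (vw i)).
by move/(value_groupE v_pi (vw i)) => h; apply/asboolP.
Qed.

Let level : exists c : 'I_t -> L, (forall i, c i != 0) /\
  (forall i, i \in I -> w i (c i) = delta%:E).
Proof.
have h i : exists c : L, c != 0 /\ (i \in I -> w i c = delta%:E).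
  have [/index_setP[c c0 wc]|ni] := pselect (i \in I); first by exists c.
  by exists 1; rewrite oner_neq0; split.
by have [c cP] := choice h; exists c; split=> i; have [] := cP i.
Qed.

(** An integer v(a) with v(a) + w(s) = delta, where both w(s) and delta lie in
    [0, 1), must be 0, and then w(s) = delta. *)
Lemma wmin_gt_off_level (a : K) s : s \in S -> wmin w s != delta%:E ->
  (delta%:E <= er_map intr (v a) + wmin w s)%E ->
  (delta%:E < er_map intr (v a) + wmin w s)%E.
Proof.
move=> sS; have [q -> q01] := basis_wmin sS; have d01 := delta_val.2.
case: (v a) => [g||] //=; rewrite -EFinD lee_fin lte_fin => qd.
rewrite le_eqVlt => /predU1P[e|//]; exfalso.
have : g = 0.
  have [g1 g2] : g%:~R < 1%:~R :> rat /\ (-1)%:~R < g%:~R :> rat by split; lra.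
  by move: g1 g2; rewrite !ltr_int; lia.
move=> g0; move: qd; rewrite g0 add0r in e.
by rewrite e eqxx.
Qed.

Lemma coef_ge0_on_level (a : K) s : wmin w s = delta%:E ->
  (delta%:E <= er_map intr (v a) + wmin w s)%E -> (0 <= v a)%E.
Proof.
move=> ->; case: (v a) => [g||] //=; rewrite -EFinD !lee_fin => h.
have : 0 <= g%:~R :> rat by lra.
by rewrite ler0z.
Qed.

Let m := size Sd.
Let sd (j : 'I_m) : L := tnth (in_tuple Sd) j.

Let sdP j : sd j \in S /\ wmin w (sd j) = delta%:E.
Proof.
by have := mem_tnth j (in_tuple Sd); rewrite mem_filter => /andP[/eqP ? ?]; split.
Qed.

Let sum_sd (a : L -> K) :
  \sum_(s <- S | wmin w s == delta%:E) a s *: s = \sum_j a (sd j) *: sd j.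
Proof. by rewrite -big_filter big_tnth. Qed.

Section Level.
Variable c : 'I_t -> L.
Hypotheses (c0 : forall i, c i != 0) (wc : forall i, i \in I -> w i (c i) = delta%:E).

Let w_div i x : i \in I -> w i (x / c i) = (w i x - delta%:E)%E.
Proof.
move=> iI; have c0' : (c i)^-1 != 0 by rewrite invr_eq0.
by rewrite Defs.valM (valE _ c0') valV0 // wc.
Qed.

Let w_div_gt0 i x : i \in I -> (0 < w i (x / c i)%R)%E = (delta%:E < w i x)%E.
Proof.
move=> iI; rewrite w_div //; case: (w i x) (valNy (w i) x) => [q||] // _.
  by rewrite -EFinB !lte_fin subr_gt0.
by rewrite addye // !ltry.
Qed.

Lemma w_div_ge0 i x : i \in I -> (0 <= w i (x / c i)%R)%E = (delta%:E <= w i x)%E.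
Proof.
move=> iI; rewrite w_div //; case: (w i x) (valNy (w i) x) => [q||] // _.
  by rewrite -EFinB !lee_fin subr_ge0.
by rewrite addye // !leey.
Qed.

(** Approximate the b i * c i at the indices of I, and 0 elsewhere, by one x to
    precision beyond delta. In the expansion of x in the basis, the terms off the
    level delta have value above delta, so they vanish in the residue fields. *)
Lemma level_span (b : 'I_t -> L) : (forall i, i \in I -> b i \in vring (w i)) ->
  exists a : L -> K, (forall j, a (sd j) \in vring v) /\
    forall i, i \in I -> (0 < w i (\sum_j a (sd j) *: sd j / c i - b i)%R)%E.
Proof.
move=> wb.
have [x xP] := weak_approximation v_pi vw w_inj
  (fun i => if i \in I then b i * c i else 0) delta.
have wx : (delta%:E <= wmin w x)%E.
  apply: wmin_ge => i; have := xP i; case: ifP => [iI|_] xi; last first.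
    by apply: ltW; rewrite -[x]subr0.
  rewrite -[x](subrK (b i * c i)); apply: le_trans (val_min _ _ _).
  rewrite le_min (ltW xi) /= Defs.valM wc // leeDr //.
  exact: wb.
have [a aE] := basis_span x.
have wa s : s \in S -> (delta%:E <= er_map intr (v (a s)) + wmin w s)%E.
  by move=> sS; apply: le_trans wx _; rewrite {1}aE; apply: wmin_sum_le.
exists a; split=> [j|i iI].
  by have [sS ws] := sdP j; apply: coef_ge0_on_level ws (wa _ sS).
pose rest := \sum_(s <- S | wmin w s != delta%:E) a s *: s.
have w_rest : (delta%:E < w i rest)%E.
  rewrite /rest big_seq_cond; apply: val_sum_gt => s /andP[sS ws].
  apply: lt_le_trans (wmin_le w i _); rewrite (wmin_scale vw).
  by apply: wmin_gt_off_level => //; apply: wa.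
have -> : \sum_j a (sd j) *: sd j / c i - b i = (x - b i * c i) / c i - rest / c i.
  have -> : x = \sum_j a (sd j) *: sd j + rest.
    by rewrite aE (bigID (fun s => wmin w s == delta%:E)) /= sum_sd.
  by rewrite -mulr_suml; field.
apply: lt_le_trans (val_min _ _ _); rewrite lt_min valN !w_div_gt0 // w_rest andbT.
by have := xP i; rewrite iI.
Qed.

(** A combination x that vanishes in all k_i has w(x) > delta, the indices outside
    I contributing for free as delta is not one of their values; by reducedness
    every coefficient then has positive value. *)
Lemma level_free (a : 'I_m -> K) : (forall j, a j \in vring v) ->
  (forall i, i \in I -> (0 < w i (\sum_j a j *: sd j / c i)%R)%E) ->
  forall j, (0 < v (a j))%E.
Proof.
move=> va wa.
have us : uniq Sd by rewrite filter_uniq ?fset_uniq.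
(* The coefficients, reindexed by the elements of the basis. *)
pose a' (s : L) := if insub (index s Sd) is Some j then a j else 0.
have a'E j : a' (sd j) = a j.
  rewrite /a' /sd (tnth_nth 0) index_uniq //.
  by rewrite insubT // => jm; congr a; apply: val_inj.
set x := \sum_j a j *: sd j.
have xE : x = \sum_(s <- S) (if wmin w s == delta%:E then a' s else 0) *: s.
  rewrite /x (eq_bigr (fun j => a' (sd j) *: sd j)) => [|j _]; last by rewrite a'E.
  rewrite -sum_sd big_mkcond /=; apply: eq_bigr => s _.
  by case: ifP => // _; rewrite scale0r.
have wx : (delta%:E < wmin w x)%E.
  apply: wmin_gt => i; have [iI|niI] := boolP (i \in I).
    by rewrite -w_div_gt0 // mulr_suml; apply: wa.
  rewrite lt_neqAle; apply/andP; split.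
    apply: contraNneq niI => e; apply/index_setP; exists x => //.
    by rewrite -(valy (w i)) -e.
  apply: val_sum_ge => j _; apply: le_trans (wmin_le w i _).
  rewrite (wmin_scale vw) (sdP j).2 leeDr //.
  by have := va j; rewrite vringE; case: (v (a j)) => [g||] //=; rewrite !lee_fin ler0z.
move=> j; have [sS ws] := sdP j.
have := lt_le_trans wx (_ : wmin w x <= _)%E.
have := wmin_sum_le (fun s => if wmin w s == delta%:E then a' s else 0) sS.
rewrite -xE ws eqxx a'E => h /(_ _ h).
case: (v (a j)) => [g||] //=; rewrite -EFinD !lte_fin => hg.
have : 0 < g%:~R :> rat by lra.
by rewrite ltr0z.
Qed.

End Level.

(** The elements of value delta in the basis become, after division by elements
    c_i of value delta, a basis of the product of the residue fields k_i over
    the i for which delta is a value of w_i. *)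
Theorem size_level : size Sd = f_delta vw delta.
Proof.
have [c [c0 wc]] := level.
pose u (j : 'I_m) i : residue_ext (vw i) := residue (w i) (sd j / c i).
have wu j i : i \in I -> sd j / c i \in vring (w i).
  move=> iI; rewrite vringE (w_div_ge0 c0 wc) //.
  by rewrite -(sdP j).2 wmin_le.
have ulift (a : 'I_m -> K) i : i \in I -> (forall j, a j \in vring v) ->
    \sum_j residue v (a j) *: u j i = residue (w i) (\sum_j a j *: (sd j / c i)).
  by move=> iI va; apply: residue_sum => // j; apply: wu.
have sum_vring (a : 'I_m -> K) i : i \in I -> (forall j, a j \in vring v) ->
    \sum_j a j *: (sd j / c i) \in vring (w i).
  by move=> iI va; apply: rpred_sum => j _; apply: (vring_scale (vw i)) => //; apply: wu.
have uspan (b : 'I_t -> L) : (forall i, i \in I -> b i \in vring (w i)) ->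
    exists a : 'I_m -> residue_field v,
      forall i, i \in I -> \sum_j a j *: u j i = residue (w i) (b i).
  move=> wb; have [a [va aP]] := level_span c0 wc wb.
  exists (fun j => residue v (a (sd j))) => i iI.
  rewrite (ulift (fun j => a (sd j))) //; apply/eqP; rewrite residue_eq ?wb //; last first.
    exact: (sum_vring (fun j => a (sd j))).
  by have := aP i iI; under eq_bigr do rewrite -scalerAl.
have ufree (b : 'I_m -> residue_field v) :
    (forall i, i \in I -> \sum_j b j *: u j i = 0) -> forall j, b j = 0.
  move=> b0.
  have /choice[a aP] j : exists a, a \in vring v /\ residue v a = b j.
    by have [a va <-] := residue_surj (b j); exists a.
  have va j : a j \in vring v by have [] := aP j.
  move=> j; have [_ <-] := aP j; apply/eqP; rewrite residue_eq0 //.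
  apply: (level_free c0 wc va) => i iI.
  rewrite (eq_bigr _ (fun j _ => esym (scalerAl _ _ _))) -residue_eq0; last exact: sum_vring.
  rewrite -ulift //; apply/eqP; rewrite -[RHS](b0 i iI); apply: eq_bigr => l _.
  by have [_ ->] := aP l.
apply: (card_product_basis (u := u)) => // [i iI|y].
  rewrite /residue_degree; case: xgetP => [d -> //|none].
  have [d hd] : exists d, inhabited (Vector.axiom d (residue_ext (vw i))).
    apply: (vector_axiom_of_span (u := fun j => u j i)) => y.
    have [x wx xy] := residue_surj y.
    have [i' i'I|a aP] := uspan (fun i' => if i' == i then x else 0).
      by case: eqVneq => [->|] //; rewrite rpred0.
    by exists a; rewrite aP // eqxx.
  by have := none d.
have /choice[b bP] i : exists b, b \in vring (w i) /\ residue (w i) b = y i.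
  by have [b wb <-] := residue_surj (y i); exists b.
have [i _|a aP] := uspan b; first by have [] := bP i.
by exists a => i iI; rewrite aP //; have [] := bP i.
Qed.

End ReducedIntegralBasis.

(** * The multiset of values of a reduced integral basis *)

Theorem theorem2p8 (K : fieldType) (v : valuation K int) (v_norm : normalized v)
    (L : fieldExtType K) (n : nat) (n_gt1 : (1 < n)%N)
    (f : {poly K}) (f_A : f \is a polyOver (vring v)) (f_monic : f \is monic)
    (f_irr : irreducible_poly f) (f_deg : size f = n.+1)
    (theta : L) (f_theta : root (map_poly (in_alg L) f) theta)
    (L_gen : <<1; theta>>%VS = {:L}%VS)
    (B_fg : integral_closure_fg L v)
    (t : nat) (w : 'I_t -> valuation L rat)
    (w_ext : forall i, extends v (w i))
    (w_inj : forall i j, w i =1 w j -> i = j)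
    (w_all : forall u : valuation L rat, extends v u -> exists i, u =1 w i)
    (S : {fset L}) (S_basis : reduced_integral_basis v w S) :
  (forall delta : rat, unit_interval_values w delta ->
     #|` [fset alpha in S | wmin w alpha == delta%:E]%fset|
       = f_delta w_ext delta) /\
  (forall q : \bar rat,
     count_mem q [seq wmin w alpha | alpha <- S] = multiset_W w_ext q).
Proof.
have [pi v_pi] := v_norm 1; have [S_int S_red] := S_basis.
have size_levelE delta : unit_interval_values w delta ->
    count (fun s => wmin w s == delta%:E) S = f_delta w_ext delta.
  by move=> dE; rewrite -size_filter; apply: (size_level v_pi).
split=> [delta dE|q].
  rewrite -size_levelE // -size_filter; apply/perm_size/uniq_perm.
  - exact: fset_uniq.
  - by rewrite filter_uniq ?fset_uniq.
  by move=> s; rewrite mem_filter !inE andbC.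
rewrite count_map; set N := count _ _.
have no_value : ~ (exists2 s, s \in S & wmin w s = q) -> N = 0%N.
  move=> none; apply/eqP; rewrite /N -leqn0 leqNgt -has_count; apply/hasPn => s sS.
  by apply/eqP => e; apply: none; exists s.
have in_unit_interval s : s \in S -> wmin w s = q ->
    exists2 d, q = d%:E & unit_interval_values w d.
  move=> sS <-; have [d sd d01] := basis_wmin v_pi w_ext w_all S_int sS.
  exists d => //; split=> //; exists s => //.
  by apply: contraNneq S_red.1 => <-.
case: q @N no_value in_unit_interval => [d||] N no_value in_unit_interval /=.
- case: asboolP => [dE|ndE]; first by rewrite -size_levelE.
  by apply: no_value => -[s sS /(in_unit_interval s sS)[d' [<-]]].
- by apply: no_value => -[s sS /(in_unit_interval s sS)[]].
- by apply: no_value => -[s sS /(in_unit_interval s sS)[]].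
Qed.
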